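(* Let $n\ge 2$ and $q\in\left(2,\frac{2n}{n-1}\right)$. There exists $\lambda>0$ such that the equation $$-\Delta_{g_{FS}}u+\lambda u=\lambda u^{q-1}$$ has a nonconstant positive solution $u$ on $(\mathbb{C}\mathbf{P}^n,g_{FS})$, invariant under the action of $U(n)$, which is degenerate, i.e. the linearized equation $-\Delta_{g_{FS}}v+\lambda v=\lambda(q-1)u^{q-2}v$ has a nontrivial solution $v$.
   Context: $g_{FS}$ is the Fubini–Study metric on $\mathbb{C}\mathbf{P}^n$, normalized so that the eigenvalues of $-\Delta_{g_{FS}}$ are $4k(k+n)$, $k\ge 0$. $\Delta_{g_{FS}}$ is the Laplace–Beltrami operator. $U(n)$ acts on $\mathbb{C}\mathbf{P}^n$ by $A\cdot[z_0:z_1:\dots:z_n]=[z_0:A(z_1,\dots,z_n)]$ (cohomogeneity one action fixing $[1:0:\dots:0]$); invariant means constant on orbits. A solution $(u_0,\lambda_0)$ of $-\Delta u+\lambda u=\lambda u^{q-1}$ is called degenerate if $-\Delta v+\lambda_0 v=\lambda_0(q-1)u_0^{q-2}v$ has a nontrivial solution. *)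

(* Defs.v *)
From mathcomp Require Import all_boot all_algebra all_classical all_reals all_analysis.
From mathcomp Require Import complex.
Set Implicit Arguments. Unset Strict Implicit. Unset Printing Implicit Defensive.
Import GRing.Theory Num.Theory numFieldNormedType.Exports.
Local Open Scope ring_scope.
Local Open Scope complex_scope.

(* Model of (CP^n, g_FS):
   A function on CP^n is a function f on C^{n+1} \ {0} with f (c z) = f z
   for all c in C^*.  Points of C^{n+1} are row vectors 'rV[R[i]]_(1 + n),
   coordinate 0 being z_0 and the block of the last n coordinates being
   (z_1,...,z_n).  C^{n+1} = R^{2n+2} via x |-> (x_re + i x_im). *)

Definition Cpt (R : realType) (n : nat) := 'rV[R[i]]_(1 + n).
Definition Rpt (R : realType) (n : nat) := 'rV[R]_((1 + n) + (1 + n)).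

Definition toC (R : realType) (n : nat) (x : Rpt R n) : Cpt R n :=
  \row_j ((lsubmx x) 0 j +i* (rsubmx x) 0 j).

Definition liftR (R : realType) (n : nat) (f : Cpt R n -> R) : Rpt R n -> R :=
  fun x => f (toC x).

Definition ebas (R : realType) (k : nat) (i : 'I_k) : 'rV[R]_k := delta_mx 0 i.

Definition eucl_lap (R : realType) (k : nat) (F : 'rV[R]_k -> R) (x : 'rV[R]_k) : R :=
  \sum_(i < k) 'D_(ebas R i) ('D_(ebas R i) F) x.

Definition C2_off0 (R : realType) (k : nat) (F : 'rV[R]_k -> R) : Prop :=
  forall x : 'rV[R]_k, x != 0 ->
    [/\ differentiable F x,
        (forall i : 'I_k, differentiable ('D_(ebas R i) F) x) &
        (forall i j : 'I_k, {for x, continuous ('D_(ebas R j) ('D_(ebas R i) F))})].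

Definition CPn_C2fun (R : realType) (n : nat) (f : Cpt R n -> R) : Prop :=
  (forall (c : R[i]) (z : Cpt R n), c != 0 -> z != 0 -> f (c *: z) = f z)
  /\ C2_off0 (liftR f).

Definition on_sphere (R : realType) (n : nat) (x : Rpt R n) : Prop :=
  \sum_(i < (1 + n) + (1 + n)) (x 0 i) ^+ 2 = 1.

(* Laplace-Beltrami of g_FS (eigenvalues 4k(k+n)), computed through the Hopf
   fibration S^{2n+1} -> CP^n: for f on CP^n, (Delta_{g_FS} f)(pi x) =
   (Delta_{S^{2n+1}} (f o pi))(x) = (Euclidean Laplacian of the 0-homogeneous
   extension of f o pi)(x) for x on the unit sphere. *)
Definition lapFS (R : realType) (n : nat) (f : Cpt R n -> R) (x : Rpt R n) : R :=
  eucl_lap (liftR f) x.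

Definition unitary_mx (R : realType) (n : nat) (A : 'M[R[i]]_n) : Prop :=
  A *m (map_mx conjc A)^T = 1%:M.

Definition Un_act (R : realType) (n : nat) (A : 'M[R[i]]_n) (z : Cpt R n) : Cpt R n :=
  row_mx (lsubmx z) (rsubmx z *m A^T).

Definition Un_invariant (R : realType) (n : nat) (f : Cpt R n -> R) : Prop :=
  forall (A : 'M[R[i]]_n) (z : Cpt R n), unitary_mx A -> f (Un_act A z) = f z.

(* Main.v *)
Require Import Defs.
From mathcomp Require Import all_boot all_algebra all_classical all_reals all_analysis.
From mathcomp Require Import complex.
From mathcomp Require Import all_order ring lra zify.
Import Order.TTheory.
Import GRing.Theory Num.Theory numFieldNormedType.Exports.
Set Implicit Arguments. Unset Strict Implicit. Unset Printing Implicit Defensive.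
Local Open Scope ring_scope.

(** Invariant functions on CP^n are functions of [t = |z_0|^2 / |z|^2], on which the
    Laplacian acts as [4 L] with [L = t (1 - t) d^2 + (1 - (n + 1) t) d].  With
    [P = u ^ (q - 2)], [c = 1 / (q - 2)] and [Lam = lam (q - 2) / 4] the equation becomes
    polynomial: [P * L P + (c - 1) t (1 - t) P'^2 + Lam P^2 (P - 1) = 0].  Writing
    [P = 1 + eps * e] and [e = phi + f], where [phi = 1 - (n + 1) t] spans the first
    eigenspace, a solution bifurcating from the constant [1] at [Lam = n + 1] is the fixed
    point of a contraction in [(f, Lam)] for the norm [sum_k |p_k| 2^k] on polynomials.  As
    [L] preserves polynomials and the radius [2] exceeds [1], the Picard iterates are
    polynomials and all their derivatives converge uniformly near [[0, 1]].

    Degeneracy comes from symmetry: since [u] is not constant, differentiating it along the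
    Killing field that mixes [z_0] and [z_1] gives the nontrivial (and not U(n)-invariant)
    solution [du/dt * Re(z_0 conj z_1) / |z|^2] of the linearized equation. *)

(** * Weighted norms on polynomials *)

Definition wnorm (R : realFieldType) (w : nat -> R) (p : {poly R}) : R :=
  \sum_(i < size p) `|p`_i| * w i.

Definition pnorm (R : realFieldType) (b : R) (p : {poly R}) : R :=
  wnorm (fun k => b ^+ k) p.

(** The weight [k ^ 2] makes this norm dominate two derivatives in the combination [radL] at the
    same radius 2, so the iteration loses no radius. It ignores the constant term, hence the
    condition that the coefficient of index 0 vanish later on. *)
Definition snorm (R : realFieldType) (p : {poly R}) : R :=
  wnorm (fun k => k%:R ^+ 2 * 2 ^+ k) p.

Section Norms.
Variable R : realFieldType.
Implicit Types (p q : {poly R}) (w : nat -> R) (a b : R).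

Lemma wnormE w p m : (size p <= m)%N -> wnorm w p = \sum_(i < m) `|p`_i| * w i.
Proof.
move=> le_pm; rewrite /wnorm (big_ord_widen m (fun i => `|p`_i| * w i)) //.
rewrite big_mkcond /=; apply: eq_bigr => i _; case: ltnP => // le_pi.
by rewrite nth_default // normr0 mul0r.
Qed.

Lemma wnorm_ge0 w p : (forall k, 0 <= w k) -> 0 <= wnorm w p.
Proof. by move=> w_ge0; apply: sumr_ge0 => i _; rewrite mulr_ge0. Qed.

Lemma wnormD w p q : (forall k, 0 <= w k) ->
  wnorm w (p + q) <= wnorm w p + wnorm w q.
Proof.
move=> w_ge0; pose m := maxn (size p) (size q).
rewrite (@wnormE _ _ m) ?size_polyD // (@wnormE _ p m) ?leq_maxl //.
rewrite (@wnormE _ q m) ?leq_maxr // -big_split /=; apply: ler_sum => i _.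
by rewrite -mulrDl ler_wpM2r // coefD ler_normD.
Qed.

Lemma wnormZ w c p : wnorm w (c *: p) = `|c| * wnorm w p.
Proof.
rewrite (@wnormE _ _ (size p)) ?size_scale_leq // mulr_sumr.
by apply: eq_bigr => i _; rewrite coefZ normrM mulrA.
Qed.

Lemma coef_le_wnorm w p k : (forall j, 0 <= w j) -> `|p`_k| * w k <= wnorm w p.
Proof.
move=> w_ge0; rewrite (@wnormE _ _ (maxn (size p) k.+1)) ?leq_maxl //.
have lt_k : (k < maxn (size p) k.+1)%N by rewrite leq_max leqnn orbT.
rewrite (bigD1 (Ordinal lt_k)) //= lerDl.
by apply: sumr_ge0 => i _; rewrite mulr_ge0.
Qed.

Lemma exp_ge0 b : 0 <= b -> forall k, 0 <= b ^+ k.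
Proof. by move=> b_ge0 k; rewrite exprn_ge0. Qed.

Lemma sqr_exp2_ge0 k : 0 <= k%:R ^+ 2 * 2 ^+ k :> R.
Proof. by rewrite mulr_ge0 ?sqr_ge0 ?exprn_ge0. Qed.

Lemma pnorm_ge0 b p : 0 <= b -> 0 <= pnorm b p.
Proof. by move=> b_ge0; apply: wnorm_ge0; exact: exp_ge0. Qed.

Lemma pnormD b p q : 0 <= b -> pnorm b (p + q) <= pnorm b p + pnorm b q.
Proof. by move=> b_ge0; apply: wnormD; exact: exp_ge0. Qed.

Lemma pnormZ b c p : pnorm b (c *: p) = `|c| * pnorm b p.
Proof. exact: wnormZ. Qed.

Lemma pnormN b p : pnorm b (- p) = pnorm b p.
Proof. by rewrite -scaleN1r pnormZ normrN1 mul1r. Qed.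

Lemma pnormC b c : pnorm b c%:P = `|c|.
Proof.
by rewrite /pnorm (@wnormE _ _ 1) ?size_polyC_leq1 // big_ord1 coefC /= expr0 mulr1.
Qed.

Lemma pnorm0 b : pnorm b 0 = 0.
Proof. by rewrite -polyC0 pnormC normr0. Qed.

Lemma pnormMXaddC b p c : pnorm b (p * 'X + c%:P) = b * pnorm b p + `|c|.
Proof.
rewrite /pnorm (@wnormE _ _ (size p).+1); last first.
  by rewrite size_MXaddC; case: ifP.
rewrite big_ord_recl coefD coefMX coefC /= add0r expr0 mulr1 addrC.
congr (_ + _); rewrite mulr_sumr; apply: eq_bigr => i _.
by rewrite /= coefD coefMX coefC /= addr0 exprS mulrCA.
Qed.

Lemma pnormMX b p : pnorm b (p * 'X) = b * pnorm b p.
Proof. by rewrite -[p * 'X]addr0 -polyC0 pnormMXaddC normr0 addr0. Qed.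

Lemma pnormX b : pnorm b 'X = b.
Proof. by rewrite -['X]mul1r pnormMX -polyC1 pnormC normr1 mulr1. Qed.

Lemma pnormM b p q : 0 <= b -> pnorm b (p * q) <= pnorm b p * pnorm b q.
Proof.
move=> b_ge0; elim/poly_ind: p => [|p c IH]; first by rewrite mul0r pnorm0 mul0r.
rewrite pnormMXaddC mulrDl -mulrAC mul_polyC.
apply: le_trans (pnormD _ _ b_ge0) _.
rewrite pnormMX pnormZ mulrDl lerD2r -mulrA.
exact: ler_wpM2l.
Qed.

Lemma pnorm_le a b p : 0 <= a <= b -> pnorm a p <= pnorm b p.
Proof.
case/andP=> a_ge0 le_ab; apply: ler_sum => i _.
by rewrite ler_wpM2l // lerXn2r // nnegrE // (le_trans a_ge0).
Qed.

Lemma horner_le_pnorm b p x : `|x| <= b -> `|p.[x]| <= pnorm b p.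
Proof.
move=> le_xb; have b_ge0 : 0 <= b by apply: le_trans le_xb.
elim/poly_ind: p => [|p c IH]; first by rewrite horner0 normr0 pnorm0.
rewrite hornerMXaddC pnormMXaddC.
apply: le_trans (ler_normD _ _) _; rewrite lerD2r normrM mulrC ler_pM //.
Qed.

(** A Cauchy estimate: the gap between the radii pays for one derivative. In Horner form the factor
    [b] splits as [(b - a) + a], one part for each term of [p + p' X]. *)
Lemma pnorm_deriv a b p : 0 <= a <= b -> (b - a) * pnorm a p^`() <= pnorm b p.
Proof.
move=> /[dup] ab /andP[a_ge0 le_ab]; have b_ge0 := le_trans a_ge0 le_ab.
elim/poly_ind: p => [|p c IH]; first by rewrite linear0 !pnorm0 mulr0.
rewrite derivMXaddC pnormMXaddC.
have := pnormD p (p^`() * 'X) a_ge0; rewrite pnormMX.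
have := pnorm_le p ab.
have := normr_ge0 c; have := pnorm_ge0 p b_ge0; have := pnorm_ge0 p a_ge0.
by have := pnorm_ge0 p^`() a_ge0; nra.
Qed.

(** A remainder bound depending on [p] only through [pnorm b p], hence uniform along a bounded
    sequence of polynomials. *)
Lemma horner_taylor a b p x y : 0 <= a -> a < b -> `|x| <= a -> `|y| <= a ->
  `|p.[x] - p.[y] - p^`().[y] * (x - y)| <= (x - y) ^+ 2 * (pnorm b p / (b - a) ^+ 2).
Proof.
move=> a_ge0 lt_ab le_xa le_ya; have d_gt0 : 0 < b - a by rewrite subr_gt0.
have b_ge0 : 0 <= b by apply: le_trans (ltW lt_ab).
elim/poly_ind: p => [|p c IH].
  by rewrite linear0 !horner0 pnorm0 !(mul0r, mulr0, subr0) normr0.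
rewrite derivMXaddC pnormMXaddC !hornerMXaddC hornerD hornerMX.
set r := p.[x] - p.[y] - _ in IH.
have -> : p.[x] * x + c - (p.[y] * y + c) - (p.[y] + p^`().[y] * y) * (x - y)
  = x * r + p^`().[y] * (x - y) ^+ 2 by rewrite /r; ring.
apply: le_trans (ler_normD _ _) _.
have h2 : `|p^`().[y] * (x - y) ^+ 2| <= (x - y) ^+ 2 * (pnorm b p / (b - a)).
  rewrite normrM mulrC ger0_norm ?sqr_ge0 // ler_wpM2l ?sqr_ge0 //.
  apply: le_trans (horner_le_pnorm _ le_ya) _.
  by rewrite ler_pdivlMr // mulrC pnorm_deriv // a_ge0 ltW.
have h1 : `|x * r| <= a * ((x - y) ^+ 2 * (pnorm b p / (b - a) ^+ 2)).
  by rewrite normrM ler_pM.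
apply: le_trans (lerD h1 h2) _.
(* With [d = b - a], the identity [a / d ^ 2 + 1 / d = b / d ^ 2] reproduces the factor [b] of
   [pnormMXaddC]. *)
have -> : a * ((x - y) ^+ 2 * (pnorm b p / (b - a) ^+ 2)) +
    (x - y) ^+ 2 * (pnorm b p / (b - a)) =
  (x - y) ^+ 2 * ((b * pnorm b p) / (b - a) ^+ 2).
  by field; rewrite gt_eqF.
apply: ler_wpM2l; first exact: sqr_ge0.
by rewrite ler_pM2r ?invr_gt0 ?exprn_gt0 // lerDl.
Qed.

End Norms.

(** * The linearized radial operator *)

Definition radL (R : realFieldType) (n : nat) (p : {poly R}) : {poly R} :=
  ('X - 'X^2) * p^`()^`() + (1 - n.+1%:R *: 'X) * p^`().

Definition zonal (R : realFieldType) (n : nat) : {poly R} := 1 - n.+1%:R *: 'X.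

Section LinearSolver.
Variables (R : realFieldType) (n : nat).
Implicit Types (p f g : {poly R}) (nu : R).

(** In the monomial basis the operator is upper bidiagonal with diagonal entries [- k (k + n)]. *)
Lemma coef_radL p k :
  (radL n p)`_k = k.+1%:R ^+ 2 * p`_k.+1 - (k * (k + n))%:R * p`_k.
Proof.
have -> : radL n p = p^`()^`() * 'X - p^`()^`() * 'X^2 + p^`()
    - n.+1%:R *: (p^`() * 'X) by rewrite /radL -!mul_polyC; ring.
have dE j (r : {poly R}) : r^`()`_j = j.+1%:R * r`_j.+1.
  by rewrite coef_deriv mulr_natl.
rewrite !(coefD, coefN, coefZ, coefMX, coefMXn, dE).
case: k => [|[|k]] /=.
- by rewrite expr1n mul0n /=; ring.
- by rewrite mul1n add1n -!natr1 /=; ring.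
by rewrite !subSS subn0 natrM natrD -!natr1; ring.
Qed.

Lemma radLD p f : radL n (p + f) = radL n p + radL n f.
Proof. by rewrite /radL !derivD; ring. Qed.

Lemma radLZ c p : radL n (c *: p) = c *: radL n p.
Proof. by rewrite /radL !derivZ scalerDr -!scalerAr. Qed.

Lemma radLB p f : radL n (p - f) = radL n p - radL n f.
Proof. by rewrite radLD -(scaleN1r f) radLZ scaleN1r. Qed.

Lemma coef_zonal k :
  (zonal R n)`_k = (k == 0%N)%:R - n.+1%:R * (k == 1%N)%:R.
Proof. by rewrite coefB coef1 coefZ coefX. Qed.

Lemma zonal_eigen : radL n (zonal R n) = - n.+1%:R *: zonal R n.
Proof.
have dz : (zonal R n)^`() = (- n.+1%:R)%:P.
  by rewrite derivB derivZ derivX -polyC1 derivC sub0r alg_polyC polyCN.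
by rewrite /radL dz derivC mulr0 add0r mulrC mul_polyC.
Qed.

(** The diagonal entry of [L + (n + 1)] is [- (k - 1) (k + n + 1)], which vanishes only at [k = 1].
    The multiplier [nu] of the kernel vector [zonal] makes up for this missing pivot, and the
    condition at index 0 removes the freedom of adding multiples of [zonal] to [f]. *)
Lemma radL_solve g :
  exists f nu, f`_0 = 0 /\ radL n f + n.+1%:R *: f + nu *: zonal R n = g.
Proof.
have [m] := ubnP (size g); elim: m g => // m IH g.
rewrite ltnS leq_eqVlt => /predU1P[sz_g|/IH //].
have [m_le2|m_gt2] := leqP m 2.
  (* Since [L X + (n + 1) X = 1], a right-hand side of degree at most 1 is matched by [f1 X] and
     [nu] alone. *)
  pose nu := - (g`_1 / n.+1%:R); pose f1 := g`_0 - nu.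
  exists (f1 *: 'X), nu; split; first by rewrite coefZ coefX mulr0.
  apply/polyP => k; rewrite 2!coefD coef_radL !coefZ !coefX coef_zonal.
  case: k => [|[|k]] /=.
  - by rewrite mul0n expr1n /f1; ring.
  - by rewrite /f1 /nu !mul1n -!natr1; field; rewrite natr1 pnatr_eq0.
  by rewrite !(mulr0, subr0, addr0) nth_default // sz_g; lia.
pose k := m.-1; pose d : R := (k.-1 * (k + n.+1))%:R.
have d_neq0 : d != 0 by rewrite pnatr_eq0 muln_eq0; lia.
(* The monomial [h] cancels the leading coefficient of [g]; the remainder has smaller size. *)
pose h := - (g`_k / d) *: 'X^k.
have [f [nu [f0 fE]]] : exists f nu, f`_0 = 0 /\
    radL n f + n.+1%:R *: f + nu *: zonal R n = g - (radL n h + n.+1%:R *: h).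
  apply: IH; rewrite (leq_trans _ (_ : (m.-1 < m)%N)) //; last by lia.
  rewrite ltnS; apply/leq_sizeP => j le_mj.
  rewrite coefB coefD coef_radL !coefZ !coefXn.
  have -> : (j.+1 == k) = false by rewrite /k; apply/eqP; lia.
  have [->|ne_jk] := eqVneq j k.
    have e : (k * (k + n))%:R - n.+1%:R = d :> R.
      apply/eqP; rewrite subr_eq -natrD eqr_nat; apply/eqP.
      by rewrite /k; nia.
    have := divfK d_neq0 g`_k; rewrite -[X in _ * X]e; set w := _ / d => <- /=.
    by move: (k * (k + n))%:R => z; ring.
  by rewrite /= !(mulr0, subr0, addr0) nth_default // sz_g; move: ne_jk; rewrite /k; lia.
exists (f + h), nu; split.
  by rewrite coefD f0 coefZ coefXn add0r; case: eqP; rewrite ?mulr0 // /k; lia.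
by rewrite radLD scalerDr -[g](subrK (radL n h + n.+1%:R *: h)) -fE; ring.
Qed.

(* The k-th coefficient equation expresses (k - 1) (k + n + 1) f_k through f_(k+1) and
   g_k; summed over k >= 2 with weights 2^k, half of the left-hand side absorbs the
   shifted term.  The equations for k = 1 and k = 0 then determine nu and f_1. *)
Lemma radL_apriori f nu g : (0 < n)%N -> f`_0 = 0 ->
  radL n f + n.+1%:R *: f + nu *: zonal R n = g ->
  snorm f + `|nu| <= 7 * pnorm 2 g.
Proof.
move=> n_gt0 f0 fE; pose G := pnorm 2 g.
have G_ge0 : 0 <= G by apply: pnorm_ge0.
have coefE k : k.+1%:R ^+ 2 * f`_k.+1 - (k * (k + n))%:R * f`_k
    + n.+1%:R * f`_k + nu * ((k == 0%N)%:R - n.+1%:R * (k == 1%N)%:R) = g`_k.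
  by rewrite -fE 2!coefD coef_radL !coefZ coef_zonal.
pose a k := k%:R ^+ 2 * `|f`_k| * 2 ^+ k : R.
have a_ge0 k : 0 <= a k by rewrite !mulr_ge0 ?sqr_ge0 ?exprn_ge0.
have step k : a k.+2 <= a k.+3 / 2 + `|g`_k.+2| * 2 ^+ k.+2.
  have := coefE k.+2; rewrite /= mulr0 subr0 mulr0 addr0 => gE.
  (* For an index [j >= 2] this says [(j - 1) (j + n + 1) >= j ^ 2], that is [n (j - 1) >= 1]; it
     relies on [0 < n]. *)
  have le_c : k.+2%:R ^+ 2 <= (k.+2 * (k.+2 + n))%:R - n.+1%:R :> R.
    by rewrite lerBrDr -natrX -natrD ler_nat; nia.
  have le1 : k.+2%:R ^+ 2 * `|f`_k.+2| <= k.+3%:R ^+ 2 * `|f`_k.+3| + `|g`_k.+2|.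
    apply: (@le_trans _ _ `|((k.+2 * (k.+2 + n))%:R - n.+1%:R) * f`_k.+2|).
      by rewrite normrM ler_wpM2r // (le_trans le_c) // ler_norm.
    rewrite (_ : _ * f`_k.+2 = k.+3%:R ^+ 2 * f`_k.+3 - g`_k.+2); last first.
      by rewrite -gE; ring.
    apply: le_trans (ler_normB _ _) _.
    by rewrite normrM [`|_ ^+ 2|]ger0_norm ?sqr_ge0.
  rewrite /a [2 ^+ k.+3]exprS; have p_gt0 : 0 < 2 ^+ k.+2 :> R by rewrite exprn_gt0.
  by nra.
pose m := maxn (size f) (size g).
have tail : \sum_(k < m) a k.+2 <= 2 * G.
  have am0 : a m.+2 = 0.
    by rewrite /a nth_default ?normr0 ?mulr0 ?mul0r // !leqW ?leq_maxl.
  have shift : \sum_(k < m) a k.+3 <= \sum_(k < m) a k.+2.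
    have e : \sum_(k < m.+1) a k.+2 = \sum_(k < m) a k.+2.
      by rewrite big_ord_recr /= am0 addr0.
    by rewrite -e big_ord_recl /= lerDr.
  have leG : \sum_(k < m) `|g`_k.+2| * 2 ^+ k.+2 <= G.
    rewrite /G /pnorm (@wnormE _ _ _ m.+2); last by rewrite !leqW ?leq_maxr.
    by rewrite 2!big_ord_recl /= addrA lerDr addr_ge0 // mulr_ge0.
  have : \sum_(k < m) a k.+2 <=
      \sum_(k < m) (a k.+3 / 2 + `|g`_k.+2| * 2 ^+ k.+2).
    by apply: ler_sum => k _.
  by rewrite big_split /= -mulr_suml; lra.
have g0 : `|g`_0| <= G.
  by have := @coef_le_wnorm _ _ g 0 (@exp_ge0 R 2 (ler0n R 2)); rewrite expr0 mulr1.
have g1 : `|g`_1| <= G / 2.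
  by rewrite ler_pdivlMr //; exact: (@coef_le_wnorm _ _ g 1 (@exp_ge0 R 2 (ler0n R 2))).
have f2 : `|f`_2| <= G / 8.
  have : a 2%N <= 2 * G.
    apply: le_trans tail; have [m0|m_gt0] := posnP m.
      have sz_f : (size f <= 2)%N.
        by apply: leq_trans (leq_maxl _ (size g)) _; rewrite -/m m0.
      have -> : a 2%N = 0 by rewrite /a nth_default // normr0 mulr0 mul0r.
      by rewrite sumr_ge0.
    by rewrite -(prednK m_gt0) big_ord_recl /= lerDl sumr_ge0.
  by rewrite /a; lra.
have nu_le : `|nu| <= G.
  have nu_eq : n.+1%:R * nu = 4 * f`_2 - g`_1.
    by have := coefE 1%N; rewrite /= mul1n add1n => <-; ring.
  have : `|n.+1%:R * nu| <= G.
    rewrite nu_eq; apply: le_trans (ler_normB _ _) _.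
    by rewrite normrM ger0_norm //; lra.
  rewrite normrM ger0_norm //; apply: le_trans.
  by rewrite ler_peMl // ler1n.
have f1 : `|f`_1| <= 2 * G.
  have -> : f`_1 = g`_0 - nu.
    by have := coefE 0%N; rewrite /= f0 => <-; ring.
  by apply: le_trans (ler_normB _ _) _; lra.
(* The constant 7 is the sum of 4 from [2 |f_1|], 2 from the tail and 1 from [nu]. *)
rewrite /snorm (@wnormE _ _ _ m.+2); last by rewrite !leqW ?leq_maxl.
rewrite 2!big_ord_recl /= f0.
rewrite (eq_bigr (fun k : 'I_m => a k.+2)); last first.
  by move=> k _; rewrite /a /bump /= !add1n; ring.
by rewrite /bump /= addn0 !expr1 normr0 -/G; lra.
Qed.

End LinearSolver.

(** * Picard iteration *)

Section NonlinearTerm.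
Variable R : realFieldType.
Implicit Types (p q f : {poly R}) (c d A B : R).

Lemma pnorm_le_snorm p : p`_0 = 0 -> pnorm 2 p <= snorm p.
Proof.
move=> p0; apply: ler_sum => -[[|k] /= _] _; first by rewrite p0 normr0 !mul0r.
by rewrite ler_wpM2l // ler_peMl ?exprn_ge0 // -natrX ler1n.
Qed.

Lemma pnorm_deriv_le_snorm p : pnorm 2 p^`() <= snorm p.
Proof.
have sz : (size p^`() <= size p)%N.
  by apply: leq_trans (leq_pred _); rewrite size_poly.
rewrite /pnorm (wnormE _ sz) /snorm (@wnormE _ _ p (size p).+1) //.
rewrite big_ord_recl expr0n /= !(mul0r, mulr0) add0r; apply: ler_sum => i _.
rewrite coef_deriv normrMn -(mulr_natr `|_|) /bump /= add1n exprS.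
have h : 0 <= `|p`_i.+1| * 2 ^+ i by rewrite mulr_ge0 ?exprn_ge0.
rewrite -mulrA mulrCA [leRHS](_ : _ = (2 * i.+1%:R) * (i.+1%:R * (`|p`_i.+1| * 2 ^+ i))).
  have k1 : 1 <= i.+1%:R :> R by rewrite ler1n.
  have k2 : 1 <= 2 * i.+1%:R :> R by lra.
  by apply: ler_peMl; rewrite // mulr_ge0.
by rewrite !exprS expr0; ring.
Qed.

(** The shifted term costs one [snorm], since its weight [2 ^ k] is below [2 ^ (k + 1)]; the
    diagonal term costs [n + 1] of them, since [k (k + n) <= (n + 1) k ^ 2]. *)
Lemma pnorm_radL_le_snorm n p : pnorm 2 (radL n p) <= n.+2%:R * snorm p.
Proof.
pose m := maxn (size (radL n p)) (size p).
rewrite /pnorm (@wnormE _ _ _ m) ?leq_maxl //.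
pose a k := `|p`_k| * (k%:R ^+ 2 * 2 ^+ k) : R.
have a_ge0 k : 0 <= a k by rewrite mulr_ge0 ?sqr_exp2_ge0.
have sE : snorm p = \sum_(k < m) a k by rewrite /snorm (@wnormE _ _ _ m) ?leq_maxr.
have shift : \sum_(k < m) a k.+1 <= snorm p.
  rewrite /snorm (@wnormE _ _ _ m.+1) ?leqW ?leq_maxr //.
  by rewrite big_ord_recl /= lerDr mulr_ge0 // sqr_exp2_ge0.
have s_ge0 : 0 <= snorm p by apply: wnorm_ge0 => k; exact: sqr_exp2_ge0.
apply: (@le_trans _ _ (\sum_(k < m) (a k.+1 + n.+1%:R * a k))).
  apply: ler_sum => k _; rewrite coef_radL.
  apply: (@le_trans _ _ ((k.+1%:R ^+ 2 * `|p`_k.+1| + (k * (k + n))%:R * `|p`_k|) * 2 ^+ k)).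
    rewrite ler_wpM2r ?exprn_ge0 //; apply: le_trans (ler_normB _ _) _.
    by rewrite normrM [X in _ + X]normrM normrX !normr_nat.
  rewrite mulrDl lerD // /a.
    have h : 0 <= k.+1%:R ^+ 2 * `|p`_k.+1| * 2 ^+ k.
      by rewrite !mulr_ge0 ?sqr_ge0 ?exprn_ge0.
    by rewrite [2 ^+ k.+1]exprS; lra.
  rewrite [leRHS](_ : _ = (n.+1%:R * k%:R ^+ 2) * `|p`_k| * 2 ^+ k); last by ring.
  rewrite ler_wpM2r ?exprn_ge0 // ler_wpM2r // -natrX -natrM ler_nat.
  by case: (nat_of_ord k) => // j; nia.
by rewrite big_split /= -mulr_sumr -sE -!natr1; lra.
Qed.

(* Bundling bounds with a Lipschitz estimate makes the property stable under products. *)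
Definition lipschitz_pair A d p q :=
  [/\ pnorm 2 p <= A, pnorm 2 q <= A & pnorm 2 (p - q) <= A * d].

Lemma lipschitz_pairD A B d p q p' q' : lipschitz_pair A d p q ->
  lipschitz_pair B d p' q' -> lipschitz_pair (A + B) d (p + p') (q + q').
Proof.
move=> [h1 h2 h3] [g1 g2 g3]; split.
- by apply: le_trans (pnormD _ _ _) _; rewrite // lerD.
- by apply: le_trans (pnormD _ _ _) _; rewrite // lerD.
rewrite opprD addrACA; apply: le_trans (pnormD _ _ _) _ => //.
by rewrite mulrDl lerD.
Qed.

Lemma lipschitz_pairM A B d p q p' q' : 0 <= d -> lipschitz_pair A d p q ->
  lipschitz_pair B d p' q' -> lipschitz_pair (2 * (A * B)) d (p * p') (q * q').
Proof.
have two : 0 <= 2 :> R by [].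
move=> d_ge0 [h1 h2 h3] [g1 g2 g3].
have [A_ge0 B_ge0] : 0 <= A /\ 0 <= B.
  by split; [apply: le_trans h1|apply: le_trans g1]; exact: pnorm_ge0.
have AB : A * B <= 2 * (A * B) by have := mulr_ge0 A_ge0 B_ge0; lra.
split.
- apply: le_trans AB; apply: le_trans (pnormM _ _ two) _.
  by rewrite ler_pM ?pnorm_ge0.
- apply: le_trans AB; apply: le_trans (pnormM _ _ two) _.
  by rewrite ler_pM ?pnorm_ge0.
have -> : p * p' - q * q' = p * (p' - q') + (p - q) * q' by ring.
apply: le_trans (pnormD _ _ two) _.
have l1 : pnorm 2 (p * (p' - q')) <= A * (B * d).
  by apply: le_trans (pnormM _ _ two) _; rewrite ler_pM ?pnorm_ge0.
have l2 : pnorm 2 ((p - q) * q') <= A * d * B.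
  by apply: le_trans (pnormM _ _ two) _; rewrite ler_pM ?pnorm_ge0.
by apply: le_trans (lerD l1 l2) _; rewrite le_eqVlt; apply/orP; left; apply/eqP; ring.
Qed.

Lemma lipschitz_pair_cst d p : 0 <= d -> lipschitz_pair (pnorm 2 p) d p p.
Proof.
by move=> d_ge0; split; rewrite // subrr pnorm0 mulr_ge0 // pnorm_ge0.
Qed.

Lemma lipschitz_pairW A B d p q : 0 <= d -> A <= B ->
  lipschitz_pair A d p q -> lipschitz_pair B d p q.
Proof.
move=> d_ge0 leAB [h1 h2 h3]; split; try exact: le_trans leAB.
by apply: le_trans h3 _; rewrite ler_wpM2r.
Qed.

Lemma snorm0 : snorm (0 : {poly R}) = 0.
Proof. by rewrite /snorm /wnorm size_poly0 big_ord0. Qed.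

Lemma snorm_ge0 p : 0 <= snorm p.
Proof. by apply: wnorm_ge0; exact: sqr_exp2_ge0. Qed.

Definition rescaled (n : nat) (X : {poly R} * R) : {poly R} := zonal R n + X.1.

(** Putting [P = 1 + eps * e] into the polynomial equation and dividing by [eps] leaves
    [L e + Lam e + eps * nonlin = 0], with [Lam = n + 1 + X.2]; the parameter [c1] will be
    [c - 1]. *)
Definition nonlin (n : nat) (c1 eps : R) (X : {poly R} * R) : {poly R} :=
  let e := rescaled n X in let Lam := (n.+1%:R + X.2)%:P in
  e * radL n e + c1%:P * (('X - 'X^2) * (e^`() * e^`()))
  + 2%:P * (Lam * (e * e)) + eps%:P * (Lam * (e * (e * e))).

Definition pairdist (X Y : {poly R} * R) : R :=
  snorm (X.1 - Y.1) + `|X.2 - Y.2|.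

Lemma pairdist_ge0 X Y : 0 <= pairdist X Y.
Proof. by rewrite addr_ge0 ?snorm_ge0. Qed.

Definition in_ball (r : R) (X : {poly R} * R) :=
  X.1`_0 = 0 /\ snorm X.1 + `|X.2| <= r.

Lemma nonlin_lipschitz n c1 : exists K, 1 <= K /\
  forall eps X Y, 0 <= eps <= 1 -> in_ball 1 X -> in_ball 1 Y ->
    lipschitz_pair K (pairdist X Y) (nonlin n c1 eps X) (nonlin n c1 eps Y).
Proof.
pose B0 := pnorm 2 (zonal R n); pose B1 := pnorm 2 (zonal R n)^`().
pose B2 := pnorm 2 (radL n (zonal R n)).
(* One constant serves for [e], [e'], [L e] and [Lam], both as a bound and as a Lipschitz constant;
   [n + 2] covers [pnorm_radL_le_snorm] and [|Lam|]. *)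
pose B := n.+2%:R + B0 + B1 + B2.
have B0_ge0 : 0 <= B0 by rewrite pnorm_ge0.
have B1_ge0 : 0 <= B1 by rewrite pnorm_ge0.
have B2_ge0 : 0 <= B2 by rewrite pnorm_ge0.
have n_ge1 : 1 <= n.+2%:R :> R by rewrite ler1n.
have two : 0 <= 2 :> R by [].
(* The constant is left open and filled in by the sum and product rules for [lipschitz_pair]; the
   added 1 secures [1 <= K]. *)
eexists (1 + _); split; last first.
  move=> eps X Y /andP[eps_ge0 eps_le1] [X0 X1] [Y0 Y1].
  have d_ge0 := pairdist_ge0 X Y; set d := pairdist X Y in d_ge0 *.
  have sd : snorm (X.1 - Y.1) <= d by rewrite lerDl.
  have nd : `|X.2 - Y.2| <= d by rewrite lerDr snorm_ge0.
  have D0 : (X.1 - Y.1)`_0 = 0 by rewrite coefB X0 Y0 subrr.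
  have sX : snorm X.1 <= 1 by apply: le_trans X1; rewrite lerDl.
  have sY : snorm Y.1 <= 1 by apply: le_trans Y1; rewrite lerDl.
  have bX : `|X.2| <= 1 by apply: le_trans X1; rewrite lerDr snorm_ge0.
  have bY : `|Y.2| <= 1 by apply: le_trans Y1; rewrite lerDr snorm_ge0.
  have dB : d <= B * d by rewrite ler_peMl // /B; lra.
  have le_e : lipschitz_pair B d (rescaled n X) (rescaled n Y).
    rewrite /rescaled; split.
    - apply: le_trans (pnormD _ _ two) _; have := pnorm_le_snorm X0.
      by rewrite -/B0 /B; lra.
    - apply: le_trans (pnormD _ _ two) _; have := pnorm_le_snorm Y0.
      by rewrite -/B0 /B; lra.
    rewrite opprD addrACA subrr add0r; apply: le_trans dB; apply: le_trans sd.
    exact: pnorm_le_snorm.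
  have le_e' : lipschitz_pair B d (rescaled n X)^`() (rescaled n Y)^`().
    rewrite /rescaled !(derivD (zonal R n)); split.
    - apply: le_trans (pnormD _ _ two) _; have := pnorm_deriv_le_snorm X.1.
      by rewrite -/B1 /B; lra.
    - apply: le_trans (pnormD _ _ two) _; have := pnorm_deriv_le_snorm Y.1.
      by rewrite -/B1 /B; lra.
    rewrite opprD addrACA subrr add0r -derivB; apply: le_trans dB.
    by apply: le_trans sd; exact: pnorm_deriv_le_snorm.
  have leL : lipschitz_pair B d (radL n (rescaled n X)) (radL n (rescaled n Y)).
    rewrite /rescaled !(radLD n (zonal R n)); split.
    - apply: le_trans (pnormD _ _ two) _; have := pnorm_radL_le_snorm n X.1.
      have : n.+2%:R * snorm X.1 <= n.+2%:R by rewrite ler_piMr.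
      by rewrite -/B2 /B; lra.
    - apply: le_trans (pnormD _ _ two) _; have := pnorm_radL_le_snorm n Y.1.
      have : n.+2%:R * snorm Y.1 <= n.+2%:R by rewrite ler_piMr.
      by rewrite -/B2 /B; lra.
    rewrite opprD addrACA subrr add0r -radLB.
    apply: le_trans (pnorm_radL_le_snorm _ _) _.
    apply: (@le_trans _ _ (n.+2%:R * d)); first by rewrite ler_wpM2l.
    by rewrite ler_wpM2r // /B; lra.
  have leLam : lipschitz_pair B d (n.+1%:R + X.2)%:P (n.+1%:R + Y.2)%:P.
    have e : n.+2%:R = n.+1%:R + 1 :> R by rewrite natr1.
    split.
    - rewrite pnormC; apply: le_trans (ler_normD _ _) _; rewrite normr_nat /B e; lra.
    - rewrite pnormC; apply: le_trans (ler_normD _ _) _; rewrite normr_nat /B e; lra.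
    rewrite -polyCB pnormC opprD addrACA subrr add0r; exact: le_trans dB.
  have le_eps : lipschitz_pair 1 d eps%:P eps%:P.
    apply: lipschitz_pairW (lipschitz_pair_cst eps%:P d_ge0) => //.
    by rewrite pnormC ger0_norm.
  have le1 A : A <= 1 + A by rewrite lerDr.
  refine (lipschitz_pairW d_ge0 (le1 _) _).
    have M A A1 p q p1 q1 := @lipschitz_pairM A A1 d p q p1 q1 d_ge0.
    have C p := lipschitz_pair_cst p d_ge0.
    rewrite /nonlin; apply: lipschitz_pairD.
      apply: lipschitz_pairD; first apply: lipschitz_pairD.
      - exact: (M _ _ _ _ _ _ le_e leL).
      - by apply/M/M/M; [exact: C|exact: C|exact: le_e'|exact: le_e'].
      - by apply/M/M/M; [exact: C|exact: leLam|exact: le_e|exact: le_e].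
    by apply/M/M/M/M; [exact: le_eps|exact: leLam|exact: le_e|exact: le_e|exact: le_e].
rewrite lerDl.
have B_ge0 : 0 <= B by rewrite /B; lra.
have P p : 0 <= pnorm 2 p by exact: pnorm_ge0.
by do ?[exact: P | exact: B_ge0 | apply: addr_ge0 | apply: mulr_ge0].
Qed.

End NonlinearTerm.

(** As [L zonal = - (n + 1) zonal], the equation for [e = zonal + f] reads [L f + (n + 1) f + nu
    zonal = - nu f - eps * nonlin]; this is its right-hand side. *)
Definition picard_rhs (R : realFieldType) (n : nat) (c1 eps : R)
    (X : {poly R} * R) : {poly R} :=
  - (X.2 *: X.1) - eps *: nonlin n c1 eps X.

Lemma picard_polynomials (R : realFieldType) (n : nat) (c1 r : R) :
  (0 < n)%N -> 0 < r <= 1 / 28 ->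
  exists eps, 0 < eps <= r /\ exists X : nat -> {poly R} * R, forall m,
    [/\ in_ball r (X m), pairdist (X m.+1) (X m) <= 2^-1 ^+ m &
        radL n (X m.+1).1 + n.+1%:R *: (X m.+1).1 + (X m.+1).2 *: zonal R n
          = picard_rhs n c1 eps (X m)].
Proof.
move=> n_gt0 /andP[r_gt0 r_le]; have two : 0 <= 2 :> R by [].
have [K [K_ge1 KP]] := nonlin_lipschitz n c1.
(* With the factor 7 of [radL_apriori] and [r <= 1 / 28], the ball is preserved because
   [7 (r ^ 2 + r / 14) <= r], and the map contracts by [7 (1 / 28 + r / 14) <= 1 / 2]. *)
pose eps := r / (14 * K).
have K_gt0 : 0 < K by lra.
have epsK : eps * K = r / 14 by rewrite /eps; field; rewrite gt_eqF.
have eps_gt0 : 0 < eps by rewrite divr_gt0 ?mulr_gt0.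
have eps_le : eps <= r by nra.
exists eps; split; first by rewrite eps_gt0.
(* Only existence is known from [radL_solve], so a solution map is chosen; its linearity is never
   asserted. *)
have [T TP] := choice (fun g => let: ex_intro f (ex_intro nu H) := radL_solve n g in
  ex_intro (fun Z : {poly R} * R => Z.1`_0 = 0 /\
    radL n Z.1 + n.+1%:R *: Z.1 + Z.2 *: zonal R n = g) (f, nu) H).
pose F X := T (picard_rhs n c1 eps X).
have eps01 : 0 <= eps <= 1 by apply/andP; split; lra.
have ballW Z : in_ball r Z -> in_ball 1 Z by case=> Z0 Zr; split => //; lra.
have F_ball Z : in_ball r Z -> in_ball r (F Z).
  move=> Zr; have [F0 FE] := TP (picard_rhs n c1 eps Z); split => //.
  apply: le_trans (radL_apriori n_gt0 F0 FE) _.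
  have [hN _ _] := KP eps Z Z eps01 (ballW _ Zr) (ballW _ Zr).
  case: Zr => Z0 Zr; have sZ := snorm_ge0 Z.1; have nZ := normr_ge0 Z.2.
  have pZ := pnorm_le_snorm Z0.
  have pZ0 := pnorm_ge0 Z.1 two.
  have h1 : `|Z.2| * pnorm 2 Z.1 <= r * r by apply: ler_pM => //; lra.
  have h2 : eps * pnorm 2 (nonlin n c1 eps Z) <= eps * K by rewrite ler_wpM2l // ltW.
  have := pnormD (- (Z.2 *: Z.1)) (- (eps *: nonlin n c1 eps Z)) two.
  rewrite !pnormN !pnormZ (ger0_norm (ltW eps_gt0)) -/(picard_rhs n c1 eps Z).
  by nra.
have F_contr Z W : in_ball r Z -> in_ball r W ->
    pairdist (F Z) (F W) <= pairdist Z W / 2.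
  move=> Zr Wr; have d_ge0 := pairdist_ge0 Z W.
  have [F0 FE] := TP (picard_rhs n c1 eps Z).
  have [G0 GE] := TP (picard_rhs n c1 eps W).
  have [_ _ hN] := KP eps Z W eps01 (ballW _ Zr) (ballW _ Wr).
  rewrite -!/(F _) in F0 FE G0 GE.
  (* The difference of two chosen solutions solves the linear equation for the difference of the
     data, so the a priori estimate bounds it. *)
  have E : radL n ((F Z).1 - (F W).1) + n.+1%:R *: ((F Z).1 - (F W).1)
      + ((F Z).2 - (F W).2) *: zonal R n
      = picard_rhs n c1 eps Z - picard_rhs n c1 eps W.
    by rewrite -FE -GE radLB scalerBr scalerBl; ring.
  have D0 : ((F Z).1 - (F W).1)`_0 = 0 by rewrite coefB F0 G0 subrr.
  apply: le_trans (radL_apriori n_gt0 D0 E) _.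
  (* The product [nu f] is split so that each term has one factor of size at most [r] and one
     difference. *)
  have -> : picard_rhs n c1 eps Z - picard_rhs n c1 eps W =
      - (Z.2 *: (Z.1 - W.1)) + (- ((Z.2 - W.2) *: W.1)
      - eps *: (nonlin n c1 eps Z - nonlin n c1 eps W)).
    by rewrite /picard_rhs !scalerBr scalerBl; ring.
  case: Zr Wr => [Z0 Zr] [W0 Wr].
  have B0 : (Z.1 - W.1)`_0 = 0 by rewrite coefB Z0 W0 subrr.
  have pD := pnorm_le_snorm B0; have pW := pnorm_le_snorm W0.
  have ge0 p := pnorm_ge0 p two.
  have h1 : `|Z.2| * pnorm 2 (Z.1 - W.1) <= r * snorm (Z.1 - W.1).
    by apply: ler_pM => //; have := snorm_ge0 Z.1; lra.
  have h2 : `|Z.2 - W.2| * pnorm 2 W.1 <= `|Z.2 - W.2| * r.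
    by apply: ler_pM => //; have := normr_ge0 W.2; lra.
  have h3 : eps * pnorm 2 (nonlin n c1 eps Z - nonlin n c1 eps W)
      <= eps * (K * pairdist Z W) by rewrite ler_wpM2l // ltW.
  rewrite mulrA epsK in h3.
  have := pnormD (- ((Z.2 - W.2) *: W.1))
    (- (eps *: (nonlin n c1 eps Z - nonlin n c1 eps W))) two.
  have := pnormD (- (Z.2 *: (Z.1 - W.1))) (- ((Z.2 - W.2) *: W.1)
      - eps *: (nonlin n c1 eps Z - nonlin n c1 eps W)) two.
  rewrite !pnormN !pnormZ (ger0_norm (ltW eps_gt0)).
  have dE : r * snorm (Z.1 - W.1) + `|Z.2 - W.2| * r = r * pairdist Z W.
    by rewrite /pairdist; ring.
  have : r * pairdist Z W <= 1 / 28 * pairdist Z W by rewrite ler_wpM2r.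
  by lra.
pose X m := iter m F (0, 0).
have X_ball m : in_ball r (X m).
  elim: m => [|m IH]; last exact: F_ball.
  by split; rewrite ?coef0 // snorm0 normr0 addr0 ltW.
exists X => m; split => //; last by have [] := TP (picard_rhs n c1 eps (X m)).
elim: m => [|m IH].
  have [_] := X_ball 1%N; rewrite expr0 /pairdist /= !subr0; lra.
rewrite exprSr; apply: le_trans (F_contr _ _ (X_ball m.+1) (X_ball m)) _.
by rewrite ler_pM2r ?invr_gt0.
Qed.

(** * Limits of polynomials *)

Section PolynomialLimits.
Local Open Scope classical_set_scope.
Local Open Scope ring_scope.
Variable R : realType.
Implicit Types (P : nat -> {poly R}) (a b t x y : R).

(** The ratio [1 / 2] is the contraction factor of the Picard map. *)
Definition geo_cauchy b P :=
  exists C : R, forall m, pnorm b (P m.+1 - P m) <= C * 2^-1 ^+ m.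

Definition plim P t : R := limn (fun m => (P m).[t]).

Lemma geo_cauchy_deriv a b P : 0 <= a -> a < b -> geo_cauchy b P ->
  geo_cauchy a (fun m => (P m)^`()).
Proof.
move=> a_ge0 lt_ab [C PC]; exists (C / (b - a)) => m.
rewrite mulrAC ler_pdivlMr ?subr_gt0 // mulrC -derivB.
by apply: le_trans (PC m); rewrite pnorm_deriv // a_ge0 ltW.
Qed.

Lemma geo_cauchy_bounded b P : 0 <= b -> geo_cauchy b P ->
  exists M, 0 <= M /\ forall m, pnorm b (P m) <= M.
Proof.
move=> b_ge0 [C PC]; have C_ge0 : 0 <= C.
  by have := le_trans (pnorm_ge0 _ b_ge0) (PC 0%N); rewrite expr0 mulr1.
exists (pnorm b (P 0%N) + 2 * C); split.
  by rewrite addr_ge0 ?pnorm_ge0 ?mulr_ge0.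
(* The induction carries the exact geometric partial sum [2 - 2 * 2^-m]. *)
move=> m; apply: (@le_trans _ _ (pnorm b (P 0%N) + (2 - 2 * 2^-1 ^+ m) * C)).
  elim: m => [|m IH]; first by rewrite expr0; lra.
  rewrite -[P m.+1](subrK (P m)); apply: le_trans (pnormD _ _ b_ge0) _.
  apply: le_trans (lerD (PC m) IH) _; rewrite exprS; lra.
rewrite lerD2l ler_wpM2r // gerBl mulr_ge0 // exprn_ge0 //.
Qed.

Lemma plim_cvg b P t : geo_cauchy b P -> `|t| <= b ->
  (fun m => (P m).[t]) @ \oo --> plim P t.
Proof.
move=> [C PC] le_tb; pose u := fun m => (P m).[t].
suff : cvgn u by [].
have cS : cvgn (series (telescope u)).
  apply: normed_cvg.
  apply: (@series_le_cvg _ _ (geometric C 2^-1)).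
  - by move=> m; exact: normr_ge0.
  - move=> m; apply: (@le_trans _ _ (pnorm b (P m.+1 - P m))) (PC m).
    exact: pnorm_ge0 (le_trans (normr_ge0 t) le_tb).
  - move=> m; rewrite /= /telescope /u /= -hornerN -hornerD.
    by apply: le_trans (horner_le_pnorm _ le_tb) (PC m).
  apply: is_cvg_geometric_series.
  by rewrite ger0_norm ?invr_ge0 //; lra.
have -> : u = (fun m => u 0%N + series (telescope u) m).
  by apply/funext => m; rewrite -eq_sum_telescope.
by apply: is_cvgD => //; exact: is_cvg_cst.
Qed.

(** By Carathéodory's criterion it suffices that the slope function be continuous at [y]; the
    quadratic remainder makes it Lipschitz there. *)
Lemma is_derive_quadratic (f : R -> R) y l K d : 0 < d ->
  (forall x, `|x - y| <= d -> `|f x - f y - l * (x - y)| <= (x - y) ^+ 2 * K) ->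
  is_derive y 1 f l.
Proof.
move=> d_gt0 fK; apply/is_derive1_caratheodory.
pose g x := if x == y then l else (f x - f y) / (x - y).
exists g; split; last by rewrite /g eqxx.
  move=> x; rewrite /g; case: eqVneq => [->|ne]; first by rewrite !subrr mulr0.
  by rewrite mulfVK // subr_eq0.
have K_ge0 : 0 <= K.
  have := fK (y + d); rewrite [y + d]addrC addrK => /(_ _)/(le_trans (normr_ge0 _)).
  by rewrite pmulr_rge0 ?exprn_gt0 //; apply; rewrite gtr0_norm.
apply/cvgrPdist_le => e e_gt0; rewrite /g eqxx.
near=> x; case: eqVneq => [_|ne]; first by rewrite subrr normr0 ltW.
have xy : 0 < `|x - y| by rewrite normr_gt0 subr_eq0.
have d0 : x - y != 0 by rewrite subr_eq0.
rewrite distrC -(ler_pM2r xy) -normrM mulrBl mulfVK //.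
have le_d : `|x - y| <= d.
  rewrite distrC; near: x; apply: cvgr_dist_le => //; exact: cvg_id.
apply: le_trans (fK _ le_d) _.
rewrite -real_normK ?num_real // expr2 mulrAC ler_pM2r //.
apply: (@le_trans _ _ (`|x - y| * (K + 1))); first by rewrite ler_wpM2l // lerDl.
rewrite -ler_pdivlMr ?ltr_wpDl //.
rewrite distrC; near: x; apply: cvgr_dist_le; first exact: cvg_id.
by rewrite divr_gt0 // ltr_wpDl.
Unshelve. all: by end_near. Qed.

(** The quadratic remainder bound of [horner_taylor] holds with one constant for all [m], so it
    survives the pointwise limit and identifies the derivative. *)
Lemma plim_is_derive b P y : geo_cauchy b P -> `|y| < b ->
  is_derive y 1 (plim P) (plim (fun m => (P m)^`()) y).
Proof.
move=> Pb lt_yb; have b_ge0 : 0 <= b by apply: le_trans (ltW lt_yb).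
pose a := (`|y| + b) / 2.
have lt_ya : `|y| < a by rewrite /a; lra.
have lt_ab : a < b by rewrite /a; lra.
have a_ge0 : 0 <= a by apply: le_trans (ltW lt_ya).
have [M [M_ge0 PM]] := geo_cauchy_bounded b_ge0 Pb.
apply: (@is_derive_quadratic _ _ _ (M / (b - a) ^+ 2) (a - `|y|)).
  by rewrite subr_gt0.
move=> x le_x; have le_xa : `|x| <= a.
  by have := ler_normD (x - y) y; rewrite subrK; lra.
have cx := plim_cvg Pb (le_trans le_xa (ltW lt_ab)).
have cy := plim_cvg Pb (ltW lt_yb).
have cd := plim_cvg (geo_cauchy_deriv a_ge0 lt_ab Pb) (ltW lt_ya).
have cl : (fun m => `|(P m).[x] - (P m).[y] - (P m)^`().[y] * (x - y)|) @ \oo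
    --> `|plim P x - plim P y - plim (fun m => (P m)^`()) y * (x - y)|.
  by apply: cvg_norm; apply: cvgB; [exact: cvgB|apply: cvgM => //; exact: cvg_cst].
apply: (cvgr_to_le cl); near=> m.
apply: le_trans (horner_taylor _ a_ge0 lt_ab le_xa (ltW lt_ya)) _.
by rewrite ler_wpM2l ?sqr_ge0 // ler_wpM2r // invr_ge0 exprn_ge0 // subr_ge0 ltW.
Unshelve. all: by end_near. Qed.

Lemma plim_le_bound b P M t : geo_cauchy b P -> `|t| <= b ->
  (forall m, pnorm b (P m) <= M) -> `|plim P t| <= M.
Proof.
move=> Pb le_tb PM; apply: (cvgr_to_le (cvg_norm (plim_cvg Pb le_tb))).
by near=> m; apply: le_trans (horner_le_pnorm _ le_tb) (PM m).
Unshelve. all: by end_near. Qed.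

End PolynomialLimits.

(** * The radial solution *)

Section Profile.
Local Open Scope classical_set_scope.
Local Open Scope ring_scope.
Variable R : realType.

Lemma horner_radL n (p : {poly R}) t : (radL n p).[t] =
  (t - t ^+ 2) * p^`()^`().[t] + (1 - n.+1%:R * t) * p^`().[t].
Proof. by rewrite /radL !hornerE. Qed.

Lemma horner_zonal n (t : R) : (zonal R n).[t] = 1 - n.+1%:R * t.
Proof. by rewrite /zonal !hornerE. Qed.

Lemma pnorm_zonal n : pnorm 2 (zonal R n) <= 2 * n.+1%:R + 1.
Proof.
have two : 0 <= 2 :> R by [].
rewrite /zonal; apply: le_trans (pnormD _ _ two) _.
by rewrite pnormN pnormZ pnormX normr_nat -polyC1 pnormC normr1; lra.
Qed.

(** Written in terms of [e] instead of [f], so that a limit can be taken in the values of [e] and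
    its first two derivatives. *)
Lemma horner_picard_rhs n c1 eps (X : {poly R} * R) t :
  let p := rescaled n X in let z := 1 - n.+1%:R * t in let s := t - t ^+ 2 in
  (picard_rhs n c1 eps X).[t] = - (X.2 * (p.[t] - z))
    - eps * (p.[t] * (s * p^`()^`().[t] + z * p^`().[t])
      + c1 * (s * (p^`().[t] * p^`().[t]))
      + 2 * ((n.+1%:R + X.2) * (p.[t] * p.[t]))
      + eps * ((n.+1%:R + X.2) * (p.[t] * (p.[t] * p.[t])))).
Proof.
move=> p z s; rewrite /picard_rhs (_ : X.1 = p - zonal R n); last first.
  by rewrite /p /rescaled addrC addKr.
rewrite /nonlin -/p; move: (radL n p) (horner_radL n p t) => L LE.
move: p LE => p; rewrite -/s -/z => LE.
rewrite (hornerD (- _)) !hornerN !hornerZ (hornerD p) hornerN horner_zonal.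
by rewrite !(hornerD, hornerM, hornerC, hornerX, hornerXn, hornerN) LE.
Qed.

(** The interval [|t| < 6 / 5] is an open neighbourhood of [[0, 1]], so the derivatives at the
    endpoints are two-sided. *)
Lemma power_profile (n : nat) (c1 : R) : (0 < n)%N ->
  exists (eps Lam : R) (e e1 e2 e3 e4 : R -> R), [/\ 0 < eps, 0 < Lam,
    forall t : R, `|t| < 6 / 5 ->
    [/\ is_derive t 1 e (e1 t), is_derive t 1 e1 (e2 t),
        is_derive t 1 e2 (e3 t), is_derive t 1 e3 (e4 t) & `|eps * e t| <= 1 / 2],
    forall t : R, `|t| < 6 / 5 ->
     (1 + eps * e t) * ((t - t ^+ 2) * e2 t + (1 - n.+1%:R * t) * e1 t)
       + c1 * eps * (t - t ^+ 2) * e1 t ^+ 2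
       + Lam * e t * (1 + eps * e t) ^+ 2 = 0 &
    e 0 != e 1 /\ e1 (1 / 2) != 0].
Proof.
move=> n_gt0; have two : 0 <= 2 :> R by [].
have N_ge1 : 1 <= n.+1%:R :> R by rewrite ler1n.
(* The factor [2 (n + 1) + 2] bounds [pnorm 2 e], by [pnorm_zonal] and the smallness of [f]; hence
   [eps * e] is at most [1 / 28]. *)
pose r : R := 1 / (28 * (2 * n.+1%:R + 2)).
have r_gt0 : 0 < r by rewrite divr_gt0 // mulr_gt0 //; lra.
have rE : r * (2 * n.+1%:R + 2) = 1 / 28.
  by rewrite /r; field; apply/eqP; lra.
have r_le : r <= 1 / 28 by nra.
have [|eps [/andP[eps_gt0 eps_le] [X XP]]] := @picard_polynomials R n c1 r n_gt0.
  by rewrite r_gt0.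
pose E m := rescaled n (X m).
have X0 m : (X m).1`_0 = 0 by have [[]] := XP m.
have sX m : snorm (X m).1 + `|(X m).2| <= r by have [[]] := XP m.
have E_geo : geo_cauchy 2 E.
  exists 1 => m; rewrite mul1r; have [_ + _] := XP m; apply: le_trans.
  rewrite /E /rescaled opprD addrACA subrr add0r.
  apply: (@le_trans _ _ (snorm ((X m.+1).1 - (X m).1))).
    by apply: pnorm_le_snorm; rewrite coefB !X0 subrr.
  by rewrite /pairdist lerDl.
have nu_geo : geo_cauchy 2 (fun m => (X m).2%:P).
  exists 1 => m; rewrite mul1r; have [_ + _] := XP m; apply: le_trans.
  by rewrite -polyCB pnormC /pairdist lerDr snorm_ge0.
pose nu := plim (fun m => (X m).2%:P) 0.
have cnu : (fun m => (X m).2) @ \oo --> nu.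
  have := @plim_cvg _ _ _ 0 nu_geo; rewrite normr0 => /(_ two).
  by under eq_fun do rewrite hornerC.
have nu_le : `|nu| <= r.
  apply: (plim_le_bound nu_geo); rewrite ?normr0 // => m.
  by rewrite pnormC; have := sX m; have := snorm_ge0 (X m).1; lra.
(* Each derivative gives up [1 / 5] of the radius, from 2 down to [7 / 5], still beyond [6 / 5]. *)
have E1_geo : geo_cauchy (9 / 5) (fun m => (E m)^`()).
  by apply: geo_cauchy_deriv E_geo; lra.
have E2_geo : geo_cauchy (8 / 5) (fun m => (E m)^`()^`()).
  by apply: geo_cauchy_deriv E1_geo; lra.
have E3_geo : geo_cauchy (7 / 5) (fun m => (E m)^`()^`()^`()).
  by apply: geo_cauchy_deriv E2_geo; lra.
pose e := plim E; pose e1 := plim (fun m => (E m)^`()).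
pose e2 := plim (fun m => (E m)^`()^`()).
pose e3 := plim (fun m => (E m)^`()^`()^`()).
pose e4 := plim (fun m => (E m)^`()^`()^`()^`()).
have f_geo : geo_cauchy 2 (fun m => (X m).1).
  exists 1 => m; rewrite mul1r; have [_ + _] := XP m; apply: le_trans.
  apply: (@le_trans _ _ (snorm ((X m.+1).1 - (X m).1))).
    by apply: pnorm_le_snorm; rewrite coefB !X0 subrr.
  by rewrite /pairdist lerDl.
have f1_geo : geo_cauchy (9 / 5) (fun m => (X m).1^`()).
  by apply: geo_cauchy_deriv f_geo; lra.
have eE t : `|t| <= 2 -> e t = 1 - n.+1%:R * t + plim (fun m => (X m).1) t.
  move=> le_t; apply: cvg_lim; first exact: norm_hausdorff.
  under eq_fun do rewrite /E /rescaled hornerD horner_zonal.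
  by apply: cvgD; [exact: cvg_cst|exact: plim_cvg f_geo le_t].
have e1E t : `|t| <= 9 / 5 -> e1 t = - n.+1%:R + plim (fun m => (X m).1^`()) t.
  move=> le_t; apply: cvg_lim; first exact: norm_hausdorff.
  have dz : (zonal R n)^`() = (- n.+1%:R)%:P.
    by rewrite derivB derivZ derivX -polyC1 derivC sub0r alg_polyC polyCN.
  under eq_fun do rewrite /E /rescaled (derivD (zonal R n)) dz hornerD hornerC.
  by apply: cvgD; [exact: cvg_cst|exact: plim_cvg f1_geo le_t].
have f_le t : `|t| <= 2 -> `|plim (fun m => (X m).1) t| <= r.
  move=> le_t; apply: (plim_le_bound f_geo le_t) => m.
  by have := pnorm_le_snorm (X0 m); have := sX m; have := normr_ge0 (X m).2; lra.
have f1_le t : `|t| <= 9 / 5 -> `|plim (fun m => (X m).1^`()) t| <= r.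
  move=> le_t; apply: (plim_le_bound f1_geo le_t) => m.
  have : pnorm (9 / 5) (X m).1^`() <= pnorm 2 (X m).1^`() by apply: pnorm_le; lra.
  by have := pnorm_deriv_le_snorm (X m).1; have := sX m; have := normr_ge0 (X m).2; lra.
exists eps, (n.+1%:R + nu), e, e1, e2, e3, e4; split.
- exact: eps_gt0.
- by move: nu_le; rewrite ler_norml => /andP[]; lra.
- move=> t lt_t; split.
  + by apply: plim_is_derive E_geo _; lra.
  + by apply: plim_is_derive E1_geo _; lra.
  + by apply: plim_is_derive E2_geo _; lra.
  + by apply: plim_is_derive E3_geo _; lra.
  rewrite normrM gtr0_norm //.
  have le_e : `|e t| <= 2 * n.+1%:R + 2.
    apply: (plim_le_bound E_geo); first by lra.
    move=> m; rewrite /E /rescaled; apply: le_trans (pnormD _ _ two) _.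
    have := pnorm_zonal n; have := pnorm_le_snorm (X0 m); have := sX m.
    by have := normr_ge0 (X m).2; lra.
  apply: (@le_trans _ _ (r * (2 * n.+1%:R + 2))); last by rewrite rE; lra.
  by rewrite ler_pM // ltW.
- move=> t lt_t.
  have ce : (fun m => (E m).[t]) @ \oo --> e t by apply: plim_cvg E_geo _; lra.
  have ce1 : (fun m => (E m)^`().[t]) @ \oo --> e1 t by apply: plim_cvg E1_geo _; lra.
  have ce2 : (fun m => (E m)^`()^`().[t]) @ \oo --> e2 t.
    by apply: plim_cvg E2_geo _; lra.
  pose z := 1 - n.+1%:R * t; pose s := t - t ^+ 2.
  pose lhs m := s * (E m)^`()^`().[t] + z * (E m)^`().[t] + n.+1%:R * (E m).[t]
     + (X m).2 * z.
  pose rhs m := - ((X m).2 * ((E m).[t] - z))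
    - eps * ((E m).[t] * (s * (E m)^`()^`().[t] + z * (E m)^`().[t])
      + c1 * (s * ((E m)^`().[t] * (E m)^`().[t]))
      + 2 * ((n.+1%:R + (X m).2) * ((E m).[t] * (E m).[t]))
      + eps * ((n.+1%:R + (X m).2) * ((E m).[t] * ((E m).[t] * (E m).[t])))).
  have lhs_rhs m : lhs m.+1 = rhs m.
    have [_ _ /(congr1 (horner^~ t))] := XP m.
    rewrite 2!hornerD !hornerZ horner_zonal -/z.
    have -> : (radL n (X m.+1).1).[t] = (radL n (E m.+1)).[t] + n.+1%:R * z.
      rewrite /E /rescaled radLD zonal_eigen hornerD hornerZ horner_zonal -/z.
      by ring.
    have -> : (X m.+1).1.[t] = (E m.+1).[t] - z.
      by rewrite /E /rescaled hornerD horner_zonal -/z; ring.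
    rewrite horner_radL horner_picard_rhs -/(E m) -/s -/z /rhs => <-.
    by rewrite /lhs; ring.
  have cst (k : R) : (fun _ : nat => k) @ \oo --> k by exact: cvg_cst.
  have cL : (fun m => s * (E m)^`()^`().[t] + z * (E m)^`().[t]) @ \oo
      --> s * e2 t + z * e1 t.
    exact: cvgD (cvgM (cst s) ce2) (cvgM (cst z) ce1).
  have cLam : (fun m => n.+1%:R + (X m).2) @ \oo --> n.+1%:R + nu.
    exact: cvgD (cst n.+1%:R) cnu.
  have c_lhs : lhs @ \oo --> s * e2 t + z * e1 t + n.+1%:R * e t + nu * z.
    exact: (cvgD (cvgD cL (cvgM (cst n.+1%:R) ce)) (cvgM cnu (cst z))).
  have c_rhs : rhs @ \oo --> - (nu * (e t - z))
    - eps * (e t * (s * e2 t + z * e1 t) + c1 * (s * (e1 t * e1 t))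
      + 2 * ((n.+1%:R + nu) * (e t * e t))
      + eps * ((n.+1%:R + nu) * (e t * (e t * e t)))).
    exact: (cvgB (cvgN (cvgM cnu (cvgB ce (cst z)))) (cvgM (cst eps)
      (cvgD (cvgD (cvgD (cvgM ce cL) (cvgM (cst c1) (cvgM (cst s) (cvgM ce1 ce1))))
        (cvgM (cst 2) (cvgM cLam (cvgM ce ce))))
        (cvgM (cst eps) (cvgM cLam (cvgM ce (cvgM ce ce))))))).
  (* The iteration equates [lhs] at [m + 1] with [rhs] at [m], and the shift does not affect the
     limit. *)
  have c_lhs' : rhs @ \oo --> s * e2 t + z * e1 t + n.+1%:R * e t + nu * z.
    have -> : rhs = (fun m => lhs m.+1) by apply/funext => m; rewrite lhs_rhs.
    by rewrite (cvg_shiftS lhs).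
  have lim_eq : s * e2 t + z * e1 t + n.+1%:R * e t + nu * z =
      - (nu * (e t - z)) - eps * (e t * (s * e2 t + z * e1 t)
      + c1 * (s * (e1 t * e1 t)) + 2 * ((n.+1%:R + nu) * (e t * e t))
      + eps * ((n.+1%:R + nu) * (e t * (e t * e t)))).
    exact: (cvg_unique (@norm_hausdorff R R^o) c_lhs' c_rhs).
  by move/eqP: lim_eq; rewrite -subr_eq0 => /eqP <-; rewrite -/s -/z; ring.
(* The limits of [f] and [f'] are at most [r] in absolute value, so [e 0 - e 1] is close to [n + 1]
   and [e1 (1 / 2)] to [- (n + 1)]. *)
split.
  rewrite !eE ?normr0 ?normr1 //; last by lra.
  have := f_le 0; have := f_le 1; rewrite normr0 normr1 => /(_ _) h1 /(_ two) h0.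
  move: (h1 ltac:(lra)) h0; rewrite !ler_norml => /andP[a1 a2] /andP[b1 b2].
  by apply/eqP; lra.
have h : `|1 / 2| <= 9 / 5 :> R by rewrite ger0_norm; lra.
rewrite e1E //; have := f1_le _ h; rewrite ler_norml => /andP[a1 a2].
by apply/eqP; lra.
Qed.

End Profile.

(** * From the polynomial profile back to the radial equation and its derivative *)

Section RadialSolution.
Variable R : realType.
Implicit Types (f g : R -> R) (t a b : R).

Lemma is_derive1M f g t a b : is_derive t 1 f a -> is_derive t 1 g b ->
  is_derive t 1 (fun z => f z * g z) (a * g t + f t * b).
Proof.
move=> fa gb; have H := @is_deriveM _ _ f g t 1 a b fa gb.
by apply: (is_derive_eq H); rewrite /GRing.scale /=; ring.
Qed.

Lemma is_derive1C t (c : R) : is_derive t 1 (fun _ : R => c) 0.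
Proof. exact: is_derive_cst. Qed.

Lemma is_derive1D f g t a b : is_derive t 1 f a -> is_derive t 1 g b ->
  is_derive t 1 (fun z => f z + g z) (a + b).
Proof. by move=> fa gb; exact: (@is_deriveD _ _ _ f g t 1 a b fa gb). Qed.

Lemma is_derive1B f g t a b : is_derive t 1 f a -> is_derive t 1 g b ->
  is_derive t 1 (fun z => f z - g z) (a - b).
Proof. by move=> fa gb; exact: (@is_deriveB _ _ _ f g t 1 a b fa gb). Qed.

Lemma is_derive1V f t a : f t != 0 -> is_derive t 1 f a ->
  is_derive t 1 (fun z => (f z)^-1) (- a / f t ^+ 2).
Proof.
move=> f_neq0 fa; apply: (is_derive_eq (is_deriveV f_neq0 fa)).
by rewrite /GRing.scale /=; field.
Qed.

Lemma mul_powR t a : 0 < t -> t * powR t a = powR t (a + 1).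
Proof.
move=> t_gt0; rewrite powRD; last by rewrite (lt0r_neq0 t_gt0) implybT.
by rewrite powRr1 1?mulrC // ltW.
Qed.

Lemma is_derive1_powR_comp f t a (c : R) : 0 < f t -> is_derive t 1 f a ->
  is_derive t 1 (fun z => powR (f z) c) (c * powR (f t) c * (a / f t)).
Proof.
move=> f_gt0 fa.
have H := @is_derive1_comp R (fun x : R => powR x c) f t _ a (is_derive1_powR c f_gt0) fa.
apply: (is_derive_eq H).
have -> : powR (f t) c = f t * powR (f t) (c - 1) by rewrite mul_powR // subrK.
by field; rewrite gt_eqF.
Qed.

(** The solution is [f = P ^ c] with [c = 1 / (q - 2)], so that [f ^ (q - 2) = P]. The second
    differential identity is the derivative of the first one in [t], arranged for the Laplacian of
    [f' * sig]. *)
Lemma radial_solution (n : nat) (q : R) : (0 < n)%N -> 2 < q ->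
  exists (lam : R) (f f1 f2 f3 : R -> R), [/\ 0 < lam,
    forall t : R, `|t| < 6 / 5 ->
    [/\ is_derive t 1 f (f1 t), is_derive t 1 f1 (f2 t), is_derive t 1 f2 (f3 t),
        {for t, continuous f3} & 0 < f t],
    forall t : R, `|t| < 6 / 5 ->
      - (4 * ((t - t ^+ 2) * f2 t + (1 - n.+1%:R * t) * f1 t)) + lam * f t
        = lam * powR (f t) (q - 1),
    forall t : R, `|t| < 6 / 5 ->
      - (4 * ((t - t ^+ 2) * f3 t + (1 - n.+1%:R * t) * f2 t
         + (1 - 2 * t) * f2 t - n.+1%:R * f1 t)) + lam * f1 t
        = lam * (q - 1) * powR (f t) (q - 2) * f1 t &
    f 0 != f 1 /\ f1 (1 / 2) != 0].
Proof.
move=> n_gt0 q_gt2; have q2 : q - 2 != 0 by apply/eqP; lra.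
pose c := (q - 2)^-1; have c_gt0 : 0 < c by rewrite invr_gt0; lra.
have [eps [Lam [e [e1 [e2 [e3 [e4 [eps_gt0 Lam_gt0 De Ee [e01 e1h]]]]]]]]] :=
  power_profile (c - 1) n_gt0.
pose P t := 1 + eps * e t.
have P_gt0 t : `|t| < 6 / 5 -> 0 < P t.
  by move=> /De[_ _ _ _]; rewrite ler_norml /P => /andP[]; lra.
have dscale (g g' : R -> R) t : is_derive t 1 g (g' t) ->
    is_derive t 1 (fun z => eps * g z) (eps * g' t).
  move=> dg; apply: (is_derive_eq (is_derive1M (is_derive1C t eps) dg)).
  by rewrite mul0r add0r.
have dP t : `|t| < 6 / 5 -> is_derive t 1 P (eps * e1 t).
  move=> /De[d0 _ _ _ _]; apply: (is_derive_eq ((is_derive1D (is_derive1C t 1) (dscale _ _ _ d0)))).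
  by rewrite add0r.
pose f t := powR (P t) c.
(* [G], [G1] and [G2] are the logarithmic derivative of [f] and its first two derivatives; every
   derivative of [f] is then [f] times a rational expression. *)
pose G t := c * (eps * e1 t * (P t)^-1).
pose G1 t := c * (eps * e2 t * (P t)^-1 - (eps * e1 t * (P t)^-1) ^+ 2).
pose G2 t := c * (eps * e3 t * (P t)^-1
  - 3 * (eps * e2 t * (P t)^-1) * (eps * e1 t * (P t)^-1)
  + 2 * (eps * e1 t * (P t)^-1) ^+ 3).
pose f1 t := f t * G t.
pose f2 t := f t * (G t * G t + G1 t).
pose f3 t := f t * (G t ^+ 3 + 3 * G t * G1 t + G2 t).
have df t : `|t| < 6 / 5 -> is_derive t 1 f (f1 t).
  move=> lt_t; apply: (is_derive_eq (is_derive1_powR_comp c (P_gt0 _ lt_t) (dP _ lt_t))).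
  by rewrite /f1 /G /f; ring.
have dG t : `|t| < 6 / 5 -> is_derive t 1 G (G1 t).
  move=> lt_t; have [_ d1 _ _ _] := De _ lt_t; have Pt := P_gt0 _ lt_t.
  have P0 : P t != 0 by rewrite gt_eqF.
  apply: (is_derive_eq ((is_derive1M (is_derive1C t c)
      (is_derive1M (dscale _ _ _ d1) (is_derive1V P0 (dP _ lt_t)))))).
  by rewrite /G1; field.
have dG1 t : `|t| < 6 / 5 -> is_derive t 1 G1 (G2 t).
  move=> lt_t; have [_ d1 d2 _ _] := De _ lt_t; have Pt := P_gt0 _ lt_t.
  have P0 : P t != 0 by rewrite gt_eqF.
  have dV := is_derive1V P0 (dP _ lt_t).
  have dA := is_derive1M (dscale _ _ _ d1) dV.
  have dB := is_derive1M (dscale _ _ _ d2) dV.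
  apply: (is_derive_eq ((is_derive1M (is_derive1C t c) (is_derive1B dB (is_derive1M dA dA))))).
  by rewrite /G2; field.
have df1 t : `|t| < 6 / 5 -> is_derive t 1 f1 (f2 t).
  move=> lt_t; apply: (is_derive_eq (is_derive1M (df _ lt_t) (dG _ lt_t))).
  by rewrite /f1 /f2; ring.
have df2 t : `|t| < 6 / 5 -> is_derive t 1 f2 (f3 t).
  move=> lt_t; apply: (is_derive_eq ((is_derive1M (df _ lt_t) (is_derive1D
      (is_derive1M (dG _ lt_t) (dG _ lt_t)) (dG1 _ lt_t))))).
  by rewrite /f1 /f3; ring.
have radE t : `|t| < 6 / 5 -> (t - t ^+ 2) * f2 t + (1 - n.+1%:R * t) * f1 t
    = - (c * Lam) * (f t * (eps * e t)).
  move=> lt_t; have P0 : P t != 0 by rewrite gt_eqF ?P_gt0.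
  have /eqP := Ee _ lt_t; rewrite -/(P t) addr_eq0 => /eqP H.
  have -> : (t - t ^+ 2) * f2 t + (1 - n.+1%:R * t) * f1 t =
    f t * c * eps * (P t) ^- 2 *
    (P t * ((t - t ^+ 2) * e2 t + (1 - n.+1%:R * t) * e1 t)
       + (c - 1) * eps * (t - t ^+ 2) * e1 t ^+ 2).
    by rewrite /f2 /f1 /G1 /G; field.
  by rewrite H; field.
have lamE : 4 * c * Lam * (q - 2) = 4 * Lam by rewrite /c; field.
have fP t : `|t| < 6 / 5 -> powR (f t) (q - 2) = P t.
  by move=> lt_t; rewrite /f -powRrM /c mulVf // powRr1 // ltW ?P_gt0.
have f_gt0 t : `|t| < 6 / 5 -> 0 < f t by move=> lt_t; rewrite powR_gt0 ?P_gt0.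
have fQ t : `|t| < 6 / 5 -> powR (f t) (q - 1) = f t * P t.
  move=> lt_t; rewrite -(fP _ lt_t) mul_powR ?f_gt0 //.
  by congr (powR _ _); ring.
exists (4 * c * Lam), f, f1, f2, f3; split.
- by rewrite !mulr_gt0.
- move=> t lt_t; split; [exact: df|exact: df1|exact: df2| |exact: f_gt0].
  (* Continuity of [f3] is drawn from its differentiability; this is where the fourth derivative
     [e4] enters. *)
  have dc (g : R -> R) l : is_derive t 1 g l -> {for t, continuous g}.
    by move=> [dg _]; apply: differentiable_continuous; apply/derivable1_diffP.
  have [_ d1 d2 d3 _] := De _ lt_t.
  have P0 : P t != 0 by rewrite gt_eqF ?P_gt0.
  have dV := is_derive1V P0 (dP _ lt_t).
  have dA := is_derive1M (dscale _ _ _ d1) dV.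
  have dB := is_derive1M (dscale _ _ _ d2) dV.
  have dC := is_derive1M (dscale _ _ _ d3) dV.
  have k := is_derive1C t.
  have dG2 := is_derive1M (k c) (is_derive1D (is_derive1B dC
    (is_derive1M (is_derive1M (k 3) dB) dA))
    (is_derive1M (k 2) (is_derive1M dA (is_derive1M dA dA)))).
  have dGt := dG _ lt_t.
  apply: dc; exact: (is_derive1M (df _ lt_t) (is_derive1D (is_derive1D
    (is_derive1M dGt (is_derive1M dGt dGt)) (is_derive1M (is_derive1M (k 3) dGt)
    (dG1 _ lt_t))) dG2)).
- by move=> t lt_t; rewrite radE // fQ // /P; ring.
- move=> t lt_t; rewrite fP //.
  have k := is_derive1C t.
  have did : is_derive t 1 (fun z : R => z) 1 by exact: is_derive_id.
  have dL := is_derive1D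
    (is_derive1M (is_derive1B did (is_derive1M did did)) (df2 _ lt_t))
    (is_derive1M (is_derive1B (k 1) (is_derive1M (k n.+1%:R) did)) (df1 _ lt_t)).
  have [d0 _ _ _ _] := De _ lt_t.
  have dR := is_derive1M (k (- (c * Lam))) (is_derive1M (df _ lt_t) (dscale _ _ _ d0)).
  have dE : (t - t ^+ 2) * f3 t + (1 - n.+1%:R * t) * f2 t
         + (1 - 2 * t) * f2 t - n.+1%:R * f1 t
      = - (c * Lam) * (f1 t * (eps * e t) + f t * (eps * e1 t)).
    (* The equation holds on a whole neighbourhood of [t], so both sides may be differentiated
       there. *)
    have nearE : \forall z \near t, (z - z * z) * f2 z + (1 - n.+1%:R * z) * f1 z
        = - (c * Lam) * (f z * (eps * e z)).
      near=> z; rewrite -expr2 radE //.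
      have : `|t - z| < 6 / 5 - `|t|.
        by near: z; apply: cvgr_dist_lt; [exact: cvg_id|rewrite subr_gt0].
      by have := ler_normB t (t - z); rewrite subKr; lra.
    have [_ vL] := near_eq_is_derive nearE dL; have [_ vR] := dR.
    by apply: (etrans _ (etrans (etrans (esym vL) vR) _)); ring.
  have fE1 : f t * (eps * e1 t) = (q - 2) * (f1 t * P t).
    by rewrite /f1 /G /c; field; rewrite q2 lt0r_neq0 ?P_gt0.
  have -> : 4 * ((t - t ^+ 2) * f3 t + (1 - n.+1%:R * t) * f2 t
         + (1 - 2 * t) * f2 t - n.+1%:R * f1 t)
      = - (4 * c * Lam) * (f1 t * (eps * e t) + (q - 2) * (f1 t * P t)).
    by rewrite dE fE1; ring.
  by rewrite /P; ring.
split.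
  apply: contra_neq e01 => f01.
  have [P00 P01] : 0 < P 0 /\ 0 < P 1.
    by split; apply: P_gt0; rewrite ?normr0 ?normr1; lra.
  have := powR_injective c_gt0 _ _ f01; rewrite !nnegrE !ltW // => /(_ isT isT).
  by move/addrI/(mulfI (lt0r_neq0 eps_gt0)).
have h : `|1 / 2| < 6 / 5 :> R by rewrite ger0_norm; lra.
rewrite /f1 /G; apply: mulf_neq0; first by rewrite lt0r_neq0 ?f_gt0.
apply: mulf_neq0; first by rewrite lt0r_neq0.
apply: mulf_neq0; first by apply: mulf_neq0 => //; rewrite lt0r_neq0.
by rewrite invr_neq0 ?lt0r_neq0 ?P_gt0.
Unshelve. all: by end_near. Qed.

End RadialSolution.

(** * Second-order calculus off the origin *)

Section Jets.
Local Open Scope classical_set_scope.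
Local Open Scope ring_scope.

(** The first-order expansion of [f] at [x] is also one of [g], because the two agree near [x]. *)
Lemma near_eq_differentiable (K : numFieldType) (V W : normedModType K)
    (f g : V -> W) (x : V) :
  {near x, f =1 g} -> differentiable f x -> differentiable g x.
Proof.
move=> fg df; have [dfc /eqaddoP dfo] := (diff_locallyP _ _).1 df.
have E : g \o shift x = cst (g x) + 'd f x +o_ 0 id.
  apply/eqaddoP => e e_gt0; near=> h.
  have fgh : f (h + x) = g (h + x).
    near: h; have c : (fun h : V => h + x) @ (0 : V) --> x.
      by rewrite -[X in _ --> X]add0r; apply: cvgD; [exact: cvg_id|exact: cvg_cst].
    exact: (c _ fg).
  have : `|(f \o shift x - (cst (f x) + 'd f x)) h| <= e * `|h| by near: h; exact: dfo.
  by rewrite /= !fctE /= fgh (nbhs_singleton fg).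
by apply/diff_locallyP; rewrite (diff_unique dfc E).
Unshelve. all: by end_near. Qed.

Variables (R : realType) (k : nat).
Let V : normedModType R := 'rV[R]_k.
Implicit Types (F : 'rV[R]_k -> R) (G : 'I_k -> 'rV[R]_k -> R)
  (H : 'I_k -> 'I_k -> 'rV[R]_k -> R) (x : 'rV[R]_k).

Lemma near_neq0 (K : numFieldType) (W : normedModType K) (x : W) :
  x != 0 -> \forall y \near x, y != 0.
Proof.
move=> x0; have x_gt0 : 0 < `|x| by rewrite normr_gt0.
near=> y; have : `|x - y| < `|x| by near: y; apply: cvgr_dist_lt => //; exact: cvg_id.
by apply: contraTneq => ->; rewrite subr0 ltxx.
Unshelve. all: by end_near. Qed.

Definition grad_at F (g : 'I_k -> R) x :=
  differentiable F x /\ forall i, 'D_(ebas R i) F x = g i.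

Lemma grad_at_cst (a : R) x : grad_at (fun _ => a) (fun _ => 0) x.
Proof. by split => [|i]; [exact: differentiable_cst|exact: derive_cst]. Qed.

Lemma grad_at_coord i x : grad_at (fun y => y 0 i) (fun j => (i == j)%:R) x.
Proof.
split=> [|j]; first exact: differentiable_coord.
have d := @differentiable_coord R 1 k x 0 i.
rewrite (deriveE _ d).
(* The coordinate is packaged as a linear map, whose differential is itself. *)
have @f : {linear 'M[R]_(1, k) -> R}.
  by exists (fun N : 'M[R]_(_, _) => N 0 i); do 2![eexists]; do ?[constructor];
     rewrite ?mxE// => ? *; rewrite ?mxE//; move=> ?; rewrite !mxE.
rewrite (_ : (fun y : 'rV[R]_k => y 0 i) = f) // diff_lin; last exact: coord_continuous.
by rewrite /= /ebas mxE eqxx.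
Qed.

Lemma grad_atD F F' g g' x : grad_at F g x -> grad_at F' g' x ->
  grad_at (fun y => F y + F' y) (fun i => g i + g' i) x.
Proof.
move=> [d dE] [d' dE']; split=> [|i]; first exact: differentiableD.
by rewrite [LHS](@deriveD _ _ _ F F') ?dE ?dE' //; exact: diff_derivable.
Qed.

Lemma grad_atM F F' g g' x : grad_at F g x -> grad_at F' g' x ->
  grad_at (fun y => F y * F' y) (fun i => g i * F' x + F x * g' i) x.
Proof.
move=> [d dE] [d' dE']; split=> [|i]; first exact: differentiableM.
rewrite [LHS](@deriveM _ _ F F') ?dE ?dE'; try exact: diff_derivable.
by rewrite /GRing.scale /=; ring.
Qed.

Lemma grad_at_comp (phi : R -> R) a F g x : grad_at F g x ->
  is_derive (F x) 1 phi a -> grad_at (fun y => phi (F y)) (fun i => a * g i) x.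
Proof.
move=> [d dE] [dphi phiE]; have dd : differentiable phi (F x) by exact/derivable1_diffP.
have dc : differentiable (phi \o F) x by exact: differentiable_comp.
split=> [//|i]; rewrite -dE (deriveE _ dc) (deriveE _ d) diff_comp //= deriv1E //.
by rewrite derive1E phiE /GRing.scale /= mulrC.
Qed.

Lemma for_continuousD F F' x : {for x, continuous F} -> {for x, continuous F'} ->
  {for x, continuous (fun y => F y + F' y)}.
Proof. by move=> c c'; exact: (cvgD c c'). Qed.

Lemma for_continuousM F F' x : {for x, continuous F} -> {for x, continuous F'} ->
  {for x, continuous (fun y => F y * F' y)}.
Proof. by move=> c c'; exact: (cvgM c c'). Qed.

(* [G] and [H] are the gradient and Hessian of [F] off the origin. *)
Definition jet F G H := forall x, x != 0 ->
  [/\ grad_at F (G^~ x) x, (forall i, grad_at (G i) ((H i)^~ x) x) &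
      forall i j, {for x, continuous (H i j)}].

(** The functions [G i] agree with the partial derivatives only off the origin, so second
    derivatives are compared on neighbourhoods that avoid it. *)
Lemma jet_C2 F G H : jet F G H -> C2_off0 F /\
  forall x, x != 0 -> eucl_lap F x = \sum_i H i i x.
Proof.
move=> J.
have near0 x : x != 0 -> \forall y \near x, y != 0.
  by move=> x0; exact: (@near_neq0 R V x).
have GE i x : x != 0 -> \forall y \near x, G i y = 'D_(ebas R i) F y.
  by move=> /near0; apply: filterS => y /J[[_ ->]].
have HE i j x : x != 0 -> 'D_(ebas R j) ('D_(ebas R i) F) x = H i j x.
  move=> x0; have [_ /(_ i)[_ <-] _] := J x x0.
  apply: near_eq_derive; apply: filterS (GE i x x0) => y; exact: esym.
split=> x x0.
  have [[dF _] dG cH] := J x x0; split=> // [i|i j].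
    by apply: near_eq_differentiable (GE i x x0) _; have [] := dG i.
  rewrite /prop_for /continuous_at HE //.
  have HD : \forall y \near x, H i j y = 'D_(ebas R j) ('D_(ebas R i) F) y.
    by near=> y; rewrite HE //; near: y; exact: near0.
  exact: cvg_trans (near_eq_cvg HD) (cH i j).
by rewrite /eucl_lap; apply: eq_bigr => i _; rewrite HE.
Unshelve. all: by end_near. Qed.

Definition gradD G G' i x : R := G i x + G' i x.
Definition hessD H H' i j x : R := H i j x + H' i j x.
Definition gradM F G F' G' i x : R := G i x * F' x + F x * G' i x.
Definition hessM F G H F' G' H' i j x : R :=
  (H i j x * F' x + G i x * G' j x) + (G j x * G' i x + F x * H' i j x).
Definition gradC (phi1 : R -> R) F G i x : R := phi1 (F x) * G i x.
Definition hessC (phi1 phi2 : R -> R) F G H i j x : R :=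
  phi2 (F x) * G j x * G i x + phi1 (F x) * H i j x.
Definition gdot G G' x : R := \sum_i G i x * G' i x.
Definition lap H x : R := \sum_i H i i x.

Lemma jetD F G H F' G' H' : jet F G H -> jet F' G' H' ->
  jet (fun x => F x + F' x) (gradD G G') (hessD H H').
Proof.
move=> J J' x x0; have [dF dG cH] := J x x0; have [dF' dG' cH'] := J' x x0.
split=> [|i|i j]; [exact: grad_atD|exact: grad_atD|].
exact: for_continuousD.
Qed.

Lemma jetM F G H F' G' H' : jet F G H -> jet F' G' H' ->
  jet (fun x => F x * F' x) (gradM F G F' G') (hessM F G H F' G' H').
Proof.
move=> J J' x x0; have [dF dG cH] := J x x0; have [dF' dG' cH'] := J' x x0.
have c F0 g : grad_at F0 g x -> {for x, continuous F0}.
  by move=> [d _]; exact: differentiable_continuous.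
split=> [|i|i j]; first exact: grad_atM.
  by apply: grad_atD; apply: grad_atM.
have [cF cF'] := (c _ _ dF, c _ _ dF').
have cG i0 := c _ _ (dG i0); have cG' i0 := c _ _ (dG' i0).
by apply: for_continuousD; apply: for_continuousD; apply: for_continuousM.
Qed.

Lemma jet_comp (phi phi1 phi2 : R -> R) F G H :
  (forall x, x != 0 -> [/\ is_derive (F x) 1 phi (phi1 (F x)),
     is_derive (F x) 1 phi1 (phi2 (F x)) & {for F x, continuous phi2}]) ->
  jet F G H -> jet (fun x => phi (F x)) (gradC phi1 F G) (hessC phi1 phi2 F G H).
Proof.
move=> P J x x0; have [d1 d2 c2] := P x x0; have [dF dG cH] := J x x0.
have c F0 g : grad_at F0 g x -> {for x, continuous F0}.
  by move=> [d _]; exact: differentiable_continuous.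
have cF := c _ _ dF; have cG i0 := c _ _ (dG i0).
split=> [|i|i j]; first exact: grad_at_comp d1.
  by apply: grad_atM (dG i); exact: grad_at_comp d2.
have c1 : {for F x, continuous phi1}.
  by case: d2 => d2 _; apply: differentiable_continuous; apply/derivable1_diffP.
have cc1 : {for x, continuous (fun y => phi1 (F y))} by exact: (continuous_comp cF c1).
have cc2 : {for x, continuous (fun y => phi2 (F y))} by exact: (continuous_comp cF c2).
by apply: for_continuousD; apply: for_continuousM => //; apply: for_continuousM.
Qed.

Lemma gdotC G G' x : gdot G G' x = gdot G' G x.
Proof. by apply: eq_bigr => i _; rewrite mulrC. Qed.

Lemma gdotDl G G' K x : gdot (gradD G G') K x = gdot G K x + gdot G' K x.
Proof. by rewrite -big_split; apply: eq_bigr => i _; rewrite /gradD /=; ring. Qed.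

Lemma gdotMl F G F' G' K x :
  gdot (gradM F G F' G') K x = F' x * gdot G K x + F x * gdot G' K x.
Proof.
by rewrite !mulr_sumr -big_split; apply: eq_bigr => i _; rewrite /gradM /=; ring.
Qed.

Lemma gdotCl phi1 F G K x : gdot (gradC phi1 F G) K x = phi1 (F x) * gdot G K x.
Proof. by rewrite mulr_sumr; apply: eq_bigr => i _; rewrite /gradC mulrA. Qed.

Lemma gdotMr F G F' G' K x :
  gdot K (gradM F G F' G') x = F' x * gdot K G x + F x * gdot K G' x.
Proof. by rewrite gdotC gdotMl (gdotC G K) (gdotC G' K). Qed.

Lemma gdotCr phi1 F G K x : gdot K (gradC phi1 F G) x = phi1 (F x) * gdot K G x.
Proof. by rewrite gdotC gdotCl gdotC. Qed.

Lemma lapD H H' x : lap (hessD H H') x = lap H x + lap H' x.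
Proof. by rewrite -big_split. Qed.

Lemma lapM F G H F' G' H' x : lap (hessM F G H F' G' H') x =
  F' x * lap H x + 2 * gdot G G' x + F x * lap H' x.
Proof.
rewrite !mulr_sumr -!big_split; apply: eq_bigr => i _; rewrite /hessM /=; ring.
Qed.

Lemma lapC phi1 phi2 F G H x : lap (hessC phi1 phi2 F G H) x =
  phi2 (F x) * gdot G G x + phi1 (F x) * lap H x.
Proof.
rewrite !mulr_sumr -!big_split; apply: eq_bigr => i _; rewrite /hessC /=; ring.
Qed.

Definition grad_coord (p i : 'I_k) (x : 'rV[R]_k) : R := (p == i)%:R.
Definition hess0 (i j : 'I_k) (x : 'rV[R]_k) : R := 0.

Lemma gdot_coord p G x : gdot (grad_coord p) G x = G p x.
Proof.
rewrite /gdot (bigD1 p) //= /grad_coord eqxx mul1r big1 ?addr0 // => i.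
by rewrite eq_sym => /negbTE ->; rewrite mul0r.
Qed.

Lemma lap0 x : lap hess0 x = 0.
Proof. by rewrite /lap big1. Qed.

Lemma jet_coord i :
  jet (fun x => x 0 i) (grad_coord i) hess0.
Proof.
move=> x _; split=> [|j|j l]; [exact: grad_at_coord|exact: grad_at_cst|exact: cst_continuous].
Qed.

Lemma jet_cst (a : R) : jet (fun _ => a) (fun _ _ => 0) hess0.
Proof.
by move=> x _; split=> [|i|i j]; [exact: grad_at_cst|exact: grad_at_cst|exact: cst_continuous].
Qed.

Definition sqnorm x : R := \sum_i x 0 i ^+ 2.
Definition grad_sqnorm (i : 'I_k) x : R := x 0 i *+ 2.
Definition hess_sqnorm (i j : 'I_k) (x : 'rV[R]_k) : R := 2 * (i == j)%:R.

Lemma jet_sqnorm : jet sqnorm grad_sqnorm hess_sqnorm.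
Proof.
(* Summing over an arbitrary sequence allows induction with the binary rule [jetD]. *)
have J (s : seq 'I_k) : jet (fun x => \sum_(l <- s) x 0 l ^+ 2)
    (fun i x => \sum_(l <- s) 2 * x 0 l * (l == i)%:R)
    (fun i j x => \sum_(l <- s) 2 * (l == i)%:R * (l == j)%:R).
  elim: s => [|l s IH].
    have := jet_cst 0; congr jet; do ?[apply/funext => ?]; by rewrite big_nil.
  have := jetD (jetM (jet_coord l) (jet_coord l)) IH.
  congr jet; do ?[apply/funext => ?]; rewrite big_cons.
  - by rewrite expr2.
  - by rewrite /gradD /gradM /grad_coord; congr (_ + _); ring.
  by rewrite /hessD /hessM /grad_coord /hess0; congr (_ + _); ring.
have pick (i : 'I_k) (h : 'I_k -> R) : \sum_l h l * (l == i)%:R = h i.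
  rewrite (bigD1 i) //= eqxx mulr1 big1 ?addr0 // => l /negbTE ->.
  by rewrite mulr0.
have := J (index_enum _); congr jet; do ?[apply/funext => ?].
- by rewrite pick mulr_natl.
by rewrite pick /hess_sqnorm eq_sym.
Qed.

Lemma gdot_sqnorm_sqnorm x : gdot grad_sqnorm grad_sqnorm x = 4 * sqnorm x.
Proof. by rewrite mulr_sumr; apply: eq_bigr => i _; rewrite /grad_sqnorm; ring. Qed.

Lemma lap_sqnorm x : lap hess_sqnorm x = 2 * k%:R.
Proof.
rewrite /lap (eq_bigr (fun => 2)) => [|i _]; last by rewrite /hess_sqnorm eqxx mulr1.
by rewrite sumr_const card_ord mulr_natr.
Qed.

Lemma sqnorm_gt0 x : x != 0 -> 0 < sqnorm x.
Proof.
move=> x0; rewrite lt0r sumr_ge0 ?andbT => [|i _]; last exact: sqr_ge0.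
apply: contra x0; rewrite psumr_eq0 => [/allP x0|i _]; last exact: sqr_ge0.
apply/eqP/rowP => i; apply/eqP; rewrite mxE -sqrf_eq0.
by have := x0 i; rewrite mem_index_enum => /(_ isT).
Qed.

Lemma jet_quotient F G H : jet F G H ->
  let inv1 y := - y ^- 2 in let inv2 y := 2 * y ^- 3 in
  jet (fun x => F x * (sqnorm x)^-1)
    (gradM F G (fun x => (sqnorm x)^-1) (gradC inv1 sqnorm grad_sqnorm))
    (hessM F G H (fun x => (sqnorm x)^-1) (gradC inv1 sqnorm grad_sqnorm)
       (hessC inv1 inv2 sqnorm grad_sqnorm hess_sqnorm)).
Proof.
move=> J inv1 inv2; apply: jetM => //; apply: jet_comp jet_sqnorm => x x0.
have r0 : sqnorm x != 0 by rewrite gt_eqF ?sqnorm_gt0.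
have did : is_derive (sqnorm x) 1 (fun y : R => y) 1 by exact: is_derive_id.
have d1 := is_derive1V r0 did.
have did2 := is_derive1M did did.
have r2 : sqnorm x * sqnorm x != 0 by rewrite mulf_neq0.
have d2 := @is_derive1V R (fun y : R => y * y) _ _ r2 did2.
have d3 := is_derive1M (is_derive1C (sqnorm x) (-1)) d2.
split.
- by apply: (is_derive_eq d1); rewrite /inv1; field.
- have -> : inv1 = (fun y => -1 * (y * y)^-1).
    by apply/funext => y; rewrite /inv1 mulN1r expr2.
  by apply: (is_derive_eq d3); rewrite /inv2; field.
have did3 := is_derive1M did did2.
have r3 : sqnorm x * (sqnorm x * sqnorm x) != 0 by rewrite mulf_neq0.
have [d4 _] := is_derive1M (is_derive1C (sqnorm x) 2) 
  (@is_derive1V R (fun y : R => y * (y * y)) _ _ r3 did3).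
have -> : inv2 = (fun y => 2 * (y * (y * y))^-1).
  by apply/funext => y; rewrite /inv2 !exprS expr0 mulr1.
by apply: differentiable_continuous; apply/derivable1_diffP.
Qed.

End Jets.

(** * Quadratic forms divided by the squared norm *)

Section Quotients.
Variables (R : realType) (k : nat).
Implicit Types (F : 'rV[R]_k -> R) (G : 'I_k -> 'rV[R]_k -> R)
  (H : 'I_k -> 'I_k -> 'rV[R]_k -> R) (x : 'rV[R]_k).

Definition grad_quot F G : 'I_k -> 'rV[R]_k -> R :=
  gradM F G (fun x => (sqnorm x)^-1)
    (gradC (fun y => - y ^- 2) (@sqnorm R k) (@grad_sqnorm R k)).

Definition hess_quot F G H : 'I_k -> 'I_k -> 'rV[R]_k -> R :=
  hessM F G H (fun x => (sqnorm x)^-1)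
    (gradC (fun y => - y ^- 2) (@sqnorm R k) (@grad_sqnorm R k))
    (hessC (fun y => - y ^- 2) (fun y => 2 * y ^- 3)
       (@sqnorm R k) (@grad_sqnorm R k) (@hess_sqnorm R k)).

(** As [grad_sqnorm] is [2 x], the hypotheses are Euler's identity in degree 2. They reduce every
    term coming from the denominator to a multiple of [F * F']. *)
Lemma gdot_quot F G F' G' x : sqnorm x = 1 ->
  gdot G (@grad_sqnorm R k) x = 4 * F x -> gdot G' (@grad_sqnorm R k) x = 4 * F' x ->
  gdot (grad_quot F G) (grad_quot F' G') x = gdot G G' x - 4 * F x * F' x.
Proof.
move=> r1 eF eF'; rewrite /grad_quot gdotMl !gdotMr !gdotCl !gdotCr.
rewrite gdot_sqnorm_sqnorm eF.
by rewrite (gdotC (@grad_sqnorm R k)) eF' r1 invr1 !expr1n invr1; ring.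
Qed.

Lemma lap_quot F G H x : sqnorm x = 1 -> gdot G (@grad_sqnorm R k) x = 4 * F x ->
  lap (hess_quot F G H) x = lap H x - 2 * k%:R * F x.
Proof.
move=> r1 eF; rewrite lapM lapC gdotCr eF gdot_sqnorm_sqnorm lap_sqnorm r1.
by rewrite !expr1n invr1; ring.
Qed.

(** For [(p, q)] and [(p', q')] the real and imaginary coordinates of [w] and [w'], this is the real
    part of [w] times the conjugate of [w']. *)
Definition bilin2 (p p' q q' : 'I_k) x : R := x 0 p * x 0 p' + x 0 q * x 0 q'.

Definition grad_bilin2 (p p' q q' : 'I_k) : 'I_k -> 'rV[R]_k -> R :=
  gradD (gradM (fun x => x 0 p) (@grad_coord R k p) (fun x => x 0 p') (@grad_coord R k p'))
   (gradM (fun x => x 0 q) (@grad_coord R k q) (fun x => x 0 q') (@grad_coord R k q')).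

Definition hess_bilin2 (p p' q q' : 'I_k) : 'I_k -> 'I_k -> 'rV[R]_k -> R :=
  hessD (hessM (fun x => x 0 p) (@grad_coord R k p) (@hess0 R k)
               (fun x => x 0 p') (@grad_coord R k p') (@hess0 R k))
    (hessM (fun x => x 0 q) (@grad_coord R k q) (@hess0 R k)
           (fun x => x 0 q') (@grad_coord R k q') (@hess0 R k)).

Lemma jet_bilin2 p p' q q' : jet (bilin2 p p' q q') (grad_bilin2 p p' q q')
  (hess_bilin2 p p' q q').
Proof. by apply: jetD; apply: jetM; exact: jet_coord. Qed.

Lemma gdot_bilin2 p p' q q' K x : gdot (grad_bilin2 p p' q q') K x =
  x 0 p' * K p x + x 0 p * K p' x + (x 0 q' * K q x + x 0 q * K q' x).
Proof. by rewrite gdotDl !gdotMl !gdot_coord. Qed.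

Lemma lap_bilin2 p p' q q' x : lap (hess_bilin2 p p' q q') x =
  2 * ((p' == p)%:R + (q' == q)%:R).
Proof. by rewrite lapD !lapM !lap0 !gdot_coord /grad_coord; ring. Qed.

Lemma bilin2_euler p p' q q' x :
  gdot (grad_bilin2 p p' q q') (@grad_sqnorm R k) x = 4 * bilin2 p p' q q' x.
Proof. by rewrite gdot_bilin2 /grad_sqnorm /bilin2; ring. Qed.

End Quotients.

(** * Laplacians of the radial function and of its derivative along a rotation *)

Section RadialLaplacian.
Variables (R : realType) (k : nat) (p0 q0 p1 q1 : 'I_k).
Hypothesis uniq_pq : uniq [:: p0; q0; p1; q1].
Variable N : R.
Hypothesis kN : k%:R = 2 * N.
Implicit Types x : 'rV[R]_k.

Let a := bilin2 (R := R) p0 p0 q0 q0.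
Let b := bilin2 (R := R) p0 p1 q0 q1.

Definition tau x : R := a x * (sqnorm x)^-1.
Definition sig x : R := b x * (sqnorm x)^-1.

Let grad_tau := grad_quot a (grad_bilin2 (R := R) p0 p0 q0 q0).
Let grad_sig := grad_quot b (grad_bilin2 (R := R) p0 p1 q0 q1).
Let hess_tau := hess_quot a (grad_bilin2 (R := R) p0 p0 q0 q0) (hess_bilin2 p0 p0 q0 q0).
Let hess_sig := hess_quot b (grad_bilin2 (R := R) p0 p1 q0 q1) (hess_bilin2 p0 p1 q0 q1).

Let jet_tau : jet tau grad_tau hess_tau.
Proof. exact: jet_quotient (jet_bilin2 _ _ _ _). Qed.

Let jet_sig : jet sig grad_sig hess_sig.
Proof. exact: jet_quotient (jet_bilin2 _ _ _ _). Qed.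

Lemma tau_bounds x : x != 0 -> 0 <= tau x <= 1.
Proof.
move=> /sqnorm_gt0 r_gt0; rewrite /tau /a /bilin2 -!expr2.
rewrite divr_ge0 ?addr_ge0 ?sqr_ge0 ?(ltW r_gt0) //= ler_pdivrMr // mul1r.
move: uniq_pq; rewrite /= !inE !negb_or => /andP[/and3P[pq _ _] _].
rewrite /sqnorm (bigD1 p0) //= (bigD1 q0) 1?eq_sym //= addrA lerDl.
by apply: sumr_ge0 => i _; exact: sqr_ge0.
Qed.

Let pq_ne : [/\ (p0 == q0) = false, (q0 == p0) = false, (p1 == p0) = false,
  (q1 == q0) = false & [/\ (p0 == p1) = false, (q0 == q1) = false,
  (p0 == q1) = false & (q0 == p1) = false]].
Proof.
move: uniq_pq; rewrite /= !inE !negb_or.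
case/and4P=> /and3P[n1 n2 n3] /andP[n4 n5] _ _.
by rewrite ![_ == p0]eq_sym ![_ == q0]eq_sym !(negbTE n1, negbTE n2, negbTE n3, negbTE n4, negbTE n5) eq_sym (negbTE n1).
Qed.

Let gdot_tau_tau x : sqnorm x = 1 ->
  gdot grad_tau grad_tau x = 4 * (tau x - tau x ^+ 2).
Proof.
move=> r1; have [e1 e2 e3 e4 [e5 e6 e7 e8]] := pq_ne.
rewrite /grad_tau gdot_quot ?bilin2_euler // gdot_bilin2.
rewrite /grad_bilin2 /gradD /gradM /grad_coord !eqxx ?e1 ?e2 /tau r1 invr1 !mulr1.
by rewrite /a /bilin2 /=; ring.
Qed.

Let gdot_tau_sig x : sqnorm x = 1 ->
  gdot grad_tau grad_sig x = 2 * sig x * (1 - 2 * tau x).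
Proof.
move=> r1; have [e1 e2 e3 e4 [e5 e6 e7 e8]] := pq_ne.
rewrite /grad_tau /grad_sig gdot_quot ?bilin2_euler // gdot_bilin2.
rewrite /grad_bilin2 /gradD /gradM /grad_coord !eqxx ?(e1, e2, e3, e4, e5, e6, e7, e8).
rewrite [q1 == p0]eq_sym [p1 == q0]eq_sym ?(e1, e2, e3, e4, e5, e6, e7, e8).
by rewrite /sig /tau r1 invr1 !mulr1 /a /b /bilin2 /=; ring.
Qed.

Let lap_tau x : sqnorm x = 1 -> lap hess_tau x = 4 * (1 - N * tau x).
Proof.
move=> r1; rewrite /hess_tau lap_quot ?bilin2_euler // lap_bilin2 !eqxx kN.
by rewrite /tau r1 invr1 mulr1 /=; ring.
Qed.

(** The numerator is harmonic because the four indices are distinct. With [N = n + 1], [sig] is an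
    eigenfunction for the first positive eigenvalue [4 (n + 1)]. *)
Let lap_sig x : sqnorm x = 1 -> lap hess_sig x = - (4 * N * sig x).
Proof.
move=> r1; have [e1 e2 e3 e4 _] := pq_ne.
rewrite /hess_sig lap_quot ?bilin2_euler // lap_bilin2 e3 e4 kN.
by rewrite /sig r1 invr1 mulr1 /=; ring.
Qed.

Variables f f1 f2 f3 : R -> R.
Hypothesis f_derive : forall t : R, 0 <= t <= 1 ->
  [/\ is_derive t 1 f (f1 t), is_derive t 1 f1 (f2 t), is_derive t 1 f2 (f3 t)
    & {for t, continuous f3}].

Let continuous_f2 t : 0 <= t <= 1 -> {for t, continuous f2}.
Proof.
by move=> /f_derive[_ _ [d _] _]; apply: differentiable_continuous; apply/derivable1_diffP.
Qed.

Lemma C2_radial : C2_off0 (fun x => f (tau x)) /\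
  forall x, sqnorm x = 1 -> x != 0 -> eucl_lap (fun x => f (tau x)) x =
    4 * ((tau x - tau x ^+ 2) * f2 (tau x) + (1 - N * tau x) * f1 (tau x)).
Proof.
have J := @jet_comp _ _ f f1 f2 _ _ _ _ jet_tau.
have [x /tau_bounds t01|C2 lapE] := jet_C2 (J _).
  by have [d1 d2 _ _] := f_derive t01; split=> //; exact: continuous_f2.
split=> // x r1 x0; rewrite lapE //.
rewrite -[LHS]/(lap _ x) lapC gdot_tau_tau // lap_tau //; ring.
Qed.

(** In the product rule the cross term gives [(1 - 2 tau) f2] and the eigenvalue of [sig] gives
    [- N f1]. The factor of [4 * sig] is thus exactly the derivative of
    [(t - t ^ 2) f2 + (1 - N t) f1], which links the linearized equation to the differentiated
    one. *)
Lemma C2_tilt : C2_off0 (fun x => f1 (tau x) * sig x) /\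
  forall x, sqnorm x = 1 -> x != 0 -> eucl_lap (fun x => f1 (tau x) * sig x) x =
    4 * sig x * ((tau x - tau x ^+ 2) * f3 (tau x) + (1 - N * tau x) * f2 (tau x)
      + (1 - 2 * tau x) * f2 (tau x) - N * f1 (tau x)).
Proof.
have J : jet (fun x => f1 (tau x)) (gradC f2 tau grad_tau)
    (hessC f2 f3 tau grad_tau hess_tau).
  apply: jet_comp jet_tau => x /tau_bounds t01.
  by have [_ d2 d3 c3] := f_derive t01.
have [C2 lapE] := jet_C2 (jetM J jet_sig).
split=> // x r1 x0; rewrite lapE // -[LHS]/(lap _ x) lapM lapC.
by rewrite gdotCl gdot_tau_sig // gdot_tau_tau // lap_tau // lap_sig //; ring.
Qed.

End RadialLaplacian.

(** * Complex projective space *)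

Section ProjectiveSpace.
Variable R : realType.

Definition sqmod (w : R[i]) : R := complex.Re w ^+ 2 + complex.Im w ^+ 2.

Lemma sqmod_ge0 w : 0 <= sqmod w.
Proof. by rewrite addr_ge0 ?sqr_ge0. Qed.

Lemma sqmod_eq0 w : (sqmod w == 0) = (w == 0).
Proof.
case: w => a b; rewrite /sqmod /= paddr_eq0 ?sqr_ge0 // !sqrf_eq0.
by rewrite eq_complex.
Qed.

Lemma sqmodM c w : sqmod (c * w) = sqmod c * sqmod w.
Proof. by case: c w => [a b] [a' b']; rewrite /sqmod /=; ring. Qed.

Definition sqmod_row m (z : 'rV[R[i]]_m) : R := \sum_j sqmod (z 0 j).

Lemma sqmod_row_gt0 m (z : 'rV[R[i]]_m) : z != 0 -> 0 < sqmod_row z.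
Proof.
move=> z0; rewrite lt0r sumr_ge0 ?andbT => [|j _]; last exact: sqmod_ge0.
apply: contra z0; rewrite psumr_eq0 => [/allP z0|j _]; last exact: sqmod_ge0.
apply/eqP/rowP => j; apply/eqP; rewrite mxE -sqmod_eq0.
by have := z0 j; rewrite mem_index_enum => /(_ isT).
Qed.

Lemma sqmod_rowZ m c (z : 'rV[R[i]]_m) : sqmod_row (c *: z) = sqmod c * sqmod_row z.
Proof. by rewrite /sqmod_row mulr_sumr; apply: eq_bigr => j _; rewrite mxE sqmodM. Qed.

(** The matrix form of the norm makes its unitary invariance a computation with matrix products. *)
Lemma sqmod_row_herm m (z : 'rV[R[i]]_m) :
  (z *m (map_mx (@conjc R) z)^T) 0 0 = (sqmod_row z)%:C%C.
Proof.
rewrite mxE /sqmod_row rmorph_sum; apply: eq_bigr => j _ /=; rewrite !mxE.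
case: (z 0 j) => a b; rewrite /sqmod /=; apply/eqP; rewrite eq_complex /=.
by apply/andP; split; apply/eqP; ring.
Qed.

Lemma sqmod_row_unitary m (A : 'M[R[i]]_m) (z : 'rV[R[i]]_m) :
  unitary_mx A -> sqmod_row (z *m A^T) = sqmod_row z.
Proof.
move=> /mulmx1C AA; have AA' : A^T *m map_mx (@conjc R) A = 1%:M.
  by rewrite -[map_mx _ _]trmxK -trmx_mul AA trmx1.
apply: (@complexI R); rewrite -!sqmod_row_herm map_mxM trmx_mul -mulmxA.
by rewrite [A^T *m _]mulmxA -map_trmx trmxK AA' mul1mx.
Qed.

Variable n : nat.
Implicit Types (z : Cpt R n) (x : Rpt R n).

Definition tauC z : R := sqmod (z 0 (lshift n ord0)) / sqmod_row z.

(* Up to a constant, the derivative of [tauC] along the rotation of [z_0] and [z_(1+j)]. *)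
Definition sigC (j : 'I_n) z : R :=
  (complex.Re (z 0 (lshift n ord0)) * complex.Re (z 0 (rshift 1 j))
   + complex.Im (z 0 (lshift n ord0)) * complex.Im (z 0 (rshift 1 j))) / sqmod_row z.

Lemma tauC_scale c z : c != 0 -> tauC (c *: z) = tauC z.
Proof.
move=> c0; rewrite /tauC sqmod_rowZ mxE sqmodM invfM mulrACA divff ?mul1r //.
by rewrite sqmod_eq0.
Qed.

Lemma sigC_scale j c z : c != 0 -> sigC j (c *: z) = sigC j z.
Proof.
rewrite -sqmod_eq0 => c0; rewrite /sigC sqmod_rowZ !mxE invfM.
set w := z 0 _; set w' := z 0 _.
rewrite (_ : _ + _ = sqmod c * (complex.Re w * complex.Re w' + complex.Im w * complex.Im w')).
  by rewrite mulrACA divff ?mul1r.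
by case: c w w' {c0} => [a b] [a1 b1] [a2 b2]; rewrite /sqmod /=; ring.
Qed.

Lemma tauC_unitary A z : unitary_mx A -> tauC (Un_act A z) = tauC z.
Proof.
move=> UA; have split_row (y : Cpt R n) :
    sqmod_row y = sqmod (y 0 (lshift n ord0)) + sqmod_row (rsubmx y).
  rewrite /sqmod_row big_split_ord /= big_ord1; congr (_ + _).
  by apply: eq_bigr => j _; rewrite mxE.
rewrite /tauC !split_row /Un_act row_mxKr sqmod_row_unitary //.
by rewrite row_mxEl mxE.
Qed.

(** Under [toC] the first half of the real coordinates holds real parts and the second half
    imaginary parts: [p0], [q0] belong to [z_0], and [p1 j], [q1 j] to [z_(1+j)]. *)
Let p0 : 'I_((1 + n) + (1 + n)) := lshift (1 + n) (lshift n ord0).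
Let q0 : 'I_((1 + n) + (1 + n)) := rshift (1 + n) (lshift n ord0).
Let p1 j : 'I_((1 + n) + (1 + n)) := lshift (1 + n) (rshift 1 j).
Let q1 j : 'I_((1 + n) + (1 + n)) := rshift (1 + n) (rshift 1 j).

Lemma sqmod_toC x : sqmod_row (toC x) = sqnorm x.
Proof.
rewrite /sqnorm big_split_ord /= -big_split /=; apply: eq_bigr => j _.
by rewrite /toC !mxE.
Qed.

Lemma tauC_toC x : tauC (toC x) = tau p0 q0 x.
Proof. by rewrite /tauC sqmod_toC /toC !mxE /sqmod /= !expr2. Qed.

Lemma sigC_toC j x : sigC j (toC x) = sig p0 q0 (p1 j) (q1 j) x.
Proof. by rewrite /sigC sqmod_toC /toC !mxE. Qed.

Lemma uniq_coords j : uniq [:: p0; q0; p1 j; q1 j].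
Proof.
rewrite /= !inE /p0 /q0 /p1 /q1 !(eq_lrshift, eq_rlshift, eq_lshift, eq_rshift).
by [].
Qed.

End ProjectiveSpace.

Theorem theorem1p3 (R : realType) (n : nat) (q : R) :
  (2 <= n)%N -> 2 < q -> q < 2 * n%:R / (n%:R - 1) ->
  exists lam : R, 0 < lam /\
  exists u : Cpt R n -> R,
    [/\ CPn_C2fun u /\ (forall z : Cpt R n, z != 0 -> 0 < u z),
        (exists z1 z2 : Cpt R n, [/\ z1 != 0, z2 != 0 & u z1 != u z2]),
        Un_invariant u,
        (forall x : Rpt R n, on_sphere x ->
           - lapFS u x + lam * u (toC x) = lam * powR (u (toC x)) (q - 1)) &
        (exists v : Cpt R n -> R,
           [/\ CPn_C2fun v,
               (exists z : Cpt R n, z != 0 /\ v z != 0) &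
               (forall x : Rpt R n, on_sphere x ->
                  - lapFS v x + lam * v (toC x)
                  = lam * (q - 1) * powR (u (toC x)) (q - 2) * v (toC x))])].
Proof.
move=> n_ge2 q_gt2 _; have n_gt0 : (0 < n)%N by apply: leq_trans n_ge2.
have [lam [f [f1 [f2 [f3 [lam_gt0 Df odef odef1 [f01 f1h]]]]]]] :=
  radial_solution n_gt0 q_gt2.
(* The index 0 selects [z_1], the coordinate mixed with [z_0] by the Killing field. *)
pose j : 'I_n := Ordinal n_gt0.
have unit_itv (t : R) : 0 <= t <= 1 -> `|t| < 6 / 5.
  by move=> /andP[t0 t1]; rewrite ger0_norm //; lra.
have tauC_itv (z : Cpt R n) : z != 0 -> 0 <= tauC z <= 1.
  move=> z0; rewrite divr_ge0 ?sqmod_ge0 ?(ltW (sqmod_row_gt0 z0)) //=.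
  rewrite ler_pdivrMr ?sqmod_row_gt0 // mul1r /sqmod_row (bigD1 (lshift n ord0)) //= lerDl.
  by apply: sumr_ge0 => i _; exact: sqmod_ge0.
have fD (t : R) : 0 <= t <= 1 -> [/\ is_derive t 1 f (f1 t), is_derive t 1 f1 (f2 t),
    is_derive t 1 f2 (f3 t) & {for t, continuous f3}].
  by move=> /unit_itv/Df[].
have kN : ((1 + n) + (1 + n))%:R = 2 * n.+1%:R :> R by rewrite add1n addnn -mul2n natrM.
have U := uniq_coords j.
have [uC2 uL] := C2_radial U kN fD; have [vC2 vL] := C2_tilt U kN fD.
pose u (z : Cpt R n) := f (tauC z); pose v (z : Cpt R n) := f1 (tauC z) * sigC j z.
have uE : liftR u = fun x => f (tau (lshift (1 + n) (lshift n ord0))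
    (rshift (1 + n) (lshift n ord0)) x).
  by apply/funext => x; rewrite /liftR /u tauC_toC.
have vE : liftR v = fun x => f1 (tau (lshift (1 + n) (lshift n ord0))
    (rshift (1 + n) (lshift n ord0)) x) * sig (lshift (1 + n) (lshift n ord0))
    (rshift (1 + n) (lshift n ord0)) (lshift (1 + n) (rshift 1 j))
    (rshift (1 + n) (rshift 1 j)) x.
  by apply/funext => x; rewrite /liftR /v tauC_toC sigC_toC.
have sphere0 (x : Rpt R n) : on_sphere x -> sqnorm x = 1 /\ x != 0.
  move=> r1; split=> //; apply: contra_eq_neq r1 => ->.
  by rewrite big1 ?(eq_sym 0) ?oner_eq0 // => i _; rewrite mxE expr0n.
(* The point [[a : b : 0 : ... : 0]], used for testing nonconstancy and nontriviality. *)
pose pt (a b : R[i]) : Cpt R n :=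
  \row_i (a * (i == lshift n ord0)%:R + b * (i == rshift 1 j)%:R).
have pt0 a b : pt a b 0 (lshift n ord0) = a.
  by rewrite mxE eqxx eq_lrshift mulr1 mulr0 addr0.
have pt1 a b : pt a b 0 (rshift 1 j) = b.
  by rewrite mxE eqxx eq_rlshift mulr1 mulr0 add0r.
have pt_norm a b : sqmod_row (pt a b) = sqmod a + sqmod b.
  rewrite /sqmod_row (bigD1 (lshift n ord0)) //= (bigD1 (rshift 1 j)) //=.
  rewrite pt0 pt1 big1 ?addr0 // => i /andP[/negbTE i0 /negbTE i1].
  by rewrite mxE i0 i1 !mulr0 addr0 /sqmod /= expr0n addr0.
have pt_neq0 a b : sqmod a + sqmod b != 0 -> pt a b != 0.
  apply: contra_neq => pt00; rewrite -pt_norm pt00 /sqmod_row big1 // => i _.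
  by rewrite mxE /sqmod /= expr0n addr0.
have sq0 : sqmod (0 : R[i]) = 0 by rewrite /sqmod /= expr0n addr0.
have sq1 : sqmod (1 : R[i]) = 1 by rewrite /sqmod /= expr0n expr1n addr0.
exists lam; split=> //; exists u; split.
- split; last by move=> z /tauC_itv/unit_itv/Df[].
  split; last by rewrite uE; exact: uC2.
  by move=> c z c0 _; rewrite /u tauC_scale.
(* At these points [tauC] is 0 and 1, so [u] takes the distinct values [f 0] and [f 1]. *)
- exists (pt 0 1), (pt 1 0).
  have n1 : pt 0 1 != 0 by apply: pt_neq0; rewrite sq0 sq1 add0r oner_eq0.
  have n2 : pt 1 0 != 0 by apply: pt_neq0; rewrite sq0 sq1 addr0 oner_eq0.
  split=> //; rewrite /u /tauC !pt_norm !pt0 sq0 sq1 add0r addr0 mul0r divr1.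
  exact: f01.
- by move=> A z UA; rewrite /u tauC_unitary.
- move=> x /sphere0[r1 x0]; rewrite /lapFS uE uL // /u tauC_toC.
  by apply: odef; apply: unit_itv; exact: (tau_bounds U).
exists v; split.
- split; last by rewrite vE; exact: vC2.
  by move=> c z c0 _; rewrite /v tauC_scale // sigC_scale.
(* Here both [tauC] and [sigC] equal [1 / 2], and [f1 (1 / 2)] is nonzero. *)
- exists (pt 1 1); split; first by apply: pt_neq0; rewrite sq1; apply/eqP; lra.
  rewrite /v /tauC /sigC pt_norm pt0 pt1 sq1 /=.
  apply: mulf_neq0; first exact: f1h.
  by rewrite !mul1r mul0r addr0 mul1r invr_neq0 //; apply/eqP; lra.
move=> x /sphere0[r1 x0]; rewrite /lapFS vE vL // /u /v tauC_toC sigC_toC.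
set s := sig _ _ _ _ x; set t := tau _ _ x.
have t_itv : `|t| < 6 / 5 by apply: unit_itv; exact: (tau_bounds U).
(* The linearized equation for [v] is the differentiated radial equation at [t] multiplied by
   [s]. *)
by rewrite [RHS]mulrA -(odef1 t t_itv); ring.
Qed.
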